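(* Let $\mathcal{D}$ be a null, recursively starlike-equivalent decomposition of length $N\geq 0$ of a compact metric space $X$ (that is, $\mathcal{D}$ is a null decomposition of $X$ each of whose elements is recursively starlike-equivalent of filtration length $N$), and let $U\subset X$ be an open set such that all the non-singleton elements of $\mathcal{D}$ lie in $U$. Then the quotient map $\pi\colon X\to X/\mathcal{D}$ is approximable by homeomorphisms agreeing with $\pi$ on $X\setminus U$; that is, there is a sequence of homeomorphisms $h_m\colon X\to X/\mathcal{D}$, each satisfying $h_m|_{X\setminus U}=\pi|_{X\setminus U}$, which converges uniformly to $\pi$.
   Context: A decomposition $\mathcal{D}$ of a space $X$ is a collection of pairwise disjoint subsets of $X$. $X/\mathcal{D}$ is the quotient space obtained by collapsing each element of $\mathcal{D}$ to a distinct point, and $\pi\colon X\to X/\mathcal{D}$ is the quotient map. For a nonempty subset $A\subset X$, $X/A$ denotes the quotient space collapsing $A$ to a point. A collection of subsets of a metric space is null if for every $\varepsilon>0$ only finitely many of its members have diameter greater than $\varepsilon$. If $X$ is compact metric and $\mathcal{D}$ is a null decomposition into compact sets, then $\mathcal{D}$ is upper semi-continuous and $X/\mathcal{D}$ is compact and metrisable; uniform convergence of maps into $X/\mathcal{D}$ is with respect to a chosen compatible metric on $X/\mathcal{D}$. A neighbourhood of a subset $S$ of a space $X$ is a subset $V\subset X$ for which there is an open set $O$ with $S\subset O\subset V$. $D^n\subset\mathbb{R}^n$ is the closed unit disc, $\operatorname{Int}D^n$ its interior, $S^{n-1}$ its boundary. A subset $E\subset \operatorname{Int}D^n$ is starlike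 if there are a point $O_E\in E$ (the origin) and an upper semi-continuous function $\rho_E\colon S^{n-1}\to[0,\infty)$ such that $E=\{O_E+t\xi\mid \xi\in S^{n-1},\ 0\le t\le\rho_E(\xi)\}$. A subset $E$ of a topological space $X$ is starlike-equivalent if, for some $n$, there is a map $f\colon N(E)\to\operatorname{Int}D^n$ from a closed neighbourhood $N(E)$ of $E$, which is a homeomorphism to its image and such that $f(E)$ is starlike. An origin for such an $E$ is $f^{-1}(O)$, where $O$ is an origin for $f(E)$; neither $f$ nor the origin need be unique. A subset $E$ of a topological space $X$ is recursively starlike-equivalent of filtration length $N$ if there is a finite filtration $\{e\}=E_{N+1}\subset E_N\subset\cdots\subset E_1\subset E_0=E$ by closed subsets $E_i$ such that, for each $0\le i\le N$, the set $E_i/E_{i+1}\subset X/E_{i+1}$ is starlike-equivalent and the point $E_{i+1}/E_{i+1}$ may be taken to be the origin of $E_i/E_{i+1}$.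
   Formalization: In the definition of starlike-equivalent, the image f(N(E)) is also required to be a neighbourhood of f(E) in R^n; without this the claim fails for X = E = [0,1], D = {E}, f(x) = x/2, since X/D is a point. *)

(* Defs.v *)
From HB Require Import structures.
From mathcomp Require Import all_boot all_order all_algebra generic_quotient.
From mathcomp Require Import all_classical all_reals all_analysis.

Set Implicit Arguments.
Unset Strict Implicit.
Unset Printing Implicit Defensive.

Import Order.TTheory GRing.Theory Num.Theory.
Import numFieldNormedType.Exports.

Local Open Scope quotient_scope.
Local Open Scope classical_set_scope.
Local Open Scope ring_scope.

(* A decomposition need not cover X. *)
Record decomposition (X : Type) := Decomposition {
  elements : set (set X);
  elements_disjoint : trivIset elements id
}.

Section DecompositionSpace.
Variables (X : topologicalType) (D : decomposition X).

Definition same_element (x y : X) : bool :=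
  `[< x = y \/ exists2 A : set X, elements D A & A x /\ A y >].

Lemma same_element_refl : reflexive same_element.
Proof. by move=> x; apply/asboolP; left. Qed.

Lemma same_element_sym : symmetric same_element.
Proof.
by move=> x y; apply/asbool_equiv_eq; split=> -[->|[A DA [Ax Ay]]];
  [left|right; exists A|left|right; exists A].
Qed.

Lemma same_element_trans : transitive same_element.
Proof.
move=> y x z /asboolP[->//|[A DA [Ax Ay]]] /asboolP[<-|[B DB [By Bz]]];
  apply/asboolP; right; first by exists A.
have eAB : A = B by apply: (elements_disjoint DA DB); exists y.
by exists A => //; split => //; rewrite eAB.
Qed.

Definition same_element_equiv : equiv_rel X :=
  EquivRel same_element same_element_refl same_element_sym same_element_trans.

Definition decomposition_space : topologicalType :=
  quotient_topology {eq_quot same_element_equiv}.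

Definition decomposition_map (x : X) : decomposition_space :=
  \pi_decomposition_space x.

End DecompositionSpace.

Section Collapse.
Variables (X : topologicalType) (A : set X).

Lemma collapse_disjoint : trivIset [set A] id.
Proof. by move=> B C -> ->. Qed.

Definition collapse : decomposition X := Decomposition collapse_disjoint.

(* X/A, for A nonempty *)
Definition quotient_by : topologicalType := decomposition_space collapse.

Definition quotient_by_map : X -> quotient_by := decomposition_map collapse.

End Collapse.

Section Starlike.
Variable R : realType.

(* The library norm on 'rV[R]_n is the sup norm, hence the explicit
   Euclidean norm; both induce the topology carried by 'rV[R]_n. *)
Definition euclidean_norm (n : nat) (x : 'rV[R]_n) : R :=
  Num.sqrt (\sum_(i < n) x ord0 i ^+ 2).

Definition open_disc (n : nat) : set 'rV[R]_n :=
  [set x | euclidean_norm x < 1].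

Definition unit_sphere (n : nat) : set 'rV[R]_n :=
  [set x | euclidean_norm x = 1].

Arguments open_disc n : clear implicits.
Arguments unit_sphere n : clear implicits.

Definition upper_semicontinuous_on (T : topologicalType) (S : set T)
    (rho : T -> R) : Prop :=
  forall x, S x -> forall a, rho x < a ->
    \forall y \near within S (nbhs x), rho y < a.

Definition starlike_with_origin (n : nat) (E : set 'rV[R]_n)
    (O : 'rV[R]_n) : Prop :=
  [/\ E `<=` open_disc n, E O &
    exists rho : 'rV[R]_n -> R,
      [/\ forall xi, unit_sphere n xi -> 0 <= rho xi,
          upper_semicontinuous_on (unit_sphere n) rho &
          E = [set x | exists xi t,
                [/\ unit_sphere n xi, 0 <= t <= rho xi & x = O + t *: xi]]]].

Definition homeomorphism_onto_image (S T : topologicalType) (A : set S)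
    (f : S -> T) : Prop :=
  {within A, continuous f} /\
  exists g : T -> S,
    {within f @` A, continuous g} /\ (forall x, A x -> g (f x) = x).

(* The condition that f @` V be a neighbourhood of f @` E is essential: without
   it, E = X = [0, 1] would be starlike-equivalent in X via x |-> x / 2 into
   the open interval Int D^1, although X is not homeomorphic to the point X/E.
   The case n = 0 never occurs, since the unit sphere is then empty. *)
Definition starlike_equivalent_with_origin (T : topologicalType) (E : set T)
    (p : T) : Prop :=
  exists (n : nat) (V : set T) (f : T -> 'rV[R]_n),
    [/\ closed V /\ set_nbhs E V,
        f @` V `<=` open_disc n,
        homeomorphism_onto_image V f,
        set_nbhs (f @` E) (f @` V) &
        E p /\ starlike_with_origin (f @` E) (f p)].

(* The point F i.+1 / F i.+1 of the quotient is the image of e. *)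
Definition recursively_starlike_equivalent (X : topologicalType) (N : nat)
    (E : set X) : Prop :=
  exists (e : X) (F : nat -> set X),
    [/\ F 0%N = E /\ F N.+1 = [set e],
        forall i, (i <= N.+1)%N -> closed (F i),
        forall i, (i <= N)%N -> F i.+1 `<=` F i &
        forall i, (i <= N)%N ->
          starlike_equivalent_with_origin
            (@quotient_by_map X (F i.+1) @` F i)
            (@quotient_by_map X (F i.+1) e)].

Definition diameter (X : metricType R) (A : set X) : \bar R :=
  ereal_sup [set (mdist x y)%:E | x in A & y in A].

Definition null_collection (X : metricType R) (D : set (set X)) : Prop :=
  forall eps : R, 0 < eps ->
    finite_set [set A | D A /\ (eps%:E < diameter A)%E].

Definition compatible_metric (T : topologicalType) (d : T -> T -> R) : Prop :=
  [/\ forall x y, 0 <= d x y,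
      forall x y, d x y = 0 <-> x = y,
      forall x y, d x y = d y x,
      forall x y z, d x z <= d x y + d y z &
      forall (x : T) (A : set T), nbhs x A <->
        exists2 eps : R, 0 < eps & [set y | d x y < eps] `<=` A].

End Starlike.

Definition homeomorphism (S T : topologicalType) (f : S -> T) : Prop :=
  continuous f /\
  exists g : T -> S, [/\ continuous g, cancel f g & cancel g f].

(* Main.v *)
(* By Bing's criterion it is enough to find, for every e and tau, a homeomorphism
   G of X supported in U, with d (pi x) (pi (G x)) < tau, making every element of
   D smaller than e.  Only finitely many elements are larger than e; they are
   treated one after the other, so one must shrink a single element A inside a
   given neighbourhood while every other element is either fixed pointwise or
   made small.  Near A the other elements are small, by nullity.

   If A carries a chart phi onto a neighbourhood of a compact set K star-shaped
   about 0, contract K radially by g v = m v *: v + (1 - m v) *: P v, where P is the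
   radial retraction onto a small ball and m is a function of the distance to K.
   That distance is nondecreasing along rays from 0, so g is injective; and m can
   be made to vary so slowly that it is almost constant on each of the other
   elements, so that g does not stretch them.  As g is the identity near 0, it
   lifts even when phi collapses a closed set E1 onto 0: this is the situation of a
   filtration step E_(i+1) in E_i, and yields a homeomorphism of X pushing E_i into
   any given neighbourhood of E_(i+1).  Composing with one that shrinks E_(i+1)
   gives the claim for E_i by downward induction. *)

Require Import Defs.
From mathcomp Require Import all_boot all_order all_algebra.
From mathcomp Require Import all_classical all_reals all_analysis.
From mathcomp Require Import ring lra.

Set Implicit Arguments.
Unset Strict Implicit.
Unset Printing Implicit Defensive.

Import Order.TTheory GRing.Theory Num.Theory.
Import numFieldNormedType.Exports.

Local Open Scope classical_set_scope.
Local Open Scope ring_scope.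

(** * Compact metric spaces *)

Lemma archimedean_inv (R : realType) (e : R) :
  0 < e -> exists n : nat, forall m, (n <= m)%N -> m.+1%:R^-1 < e.
Proof.
move=> e0; have [n _ H] := near_infty_natSinv_lt (PosNum e0).
by exists n => m nm; exact: H.
Qed.

Lemma compact_seq_cluster (T : topologicalType) (u : nat -> T) :
  compact [set: T] ->
  exists x : T, forall W, nbhs x W -> forall n, exists m, (n <= m)%N /\ W (u m).
Proof.
move=> cT; have [|x [_ cx]] := cT (u @ \oo) _; first by exists 0%N.
exists x => W xW n.
have [] := cx [set u m | m in [set m | (n <= m)%N]] W _ xW.
  by exists n => // m /= nm; exists m.
by move=> _ [[m /= nm <-] Wm]; exists m.
Qed.

Section MetricSpace.
Context {R : realType} {X : metricType R}.
Implicit Types (x y z : X) (A B C E V W : set X).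

Lemma nbhs_mdist_lt x W :
  nbhs x W <-> exists2 e : R, 0 < e & forall y, mdist x y < e -> W y.
Proof. exact: metricType_numDomainType.nbhs_mdistP. Qed.

Lemma open_mdist_lt W x :
  open W -> W x -> exists2 e : R, 0 < e & forall y, mdist x y < e -> W y.
Proof. by move=> oW Wx; apply/nbhs_mdist_lt; exact: open_nbhs_nbhs. Qed.

Lemma open_from_mdist W :
  (forall x, W x -> exists2 e : R, 0 < e & forall y, mdist x y < e -> W y) ->
  open W.
Proof. by move=> H; rewrite openE => x /H/nbhs_mdist_lt. Qed.

Lemma closed_adherent A x : closed A ->
  (forall e : R, 0 < e -> exists y, A y /\ mdist x y < e) -> A x.
Proof.
move=> cA H; apply: cA => W /nbhs_mdist_lt[e e0 eW].
by have [y [Ay xy]] := H _ e0; exists y; split=> //; exact: eW.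
Qed.

Lemma mdist_eq0_lt x y : (forall e : R, 0 < e -> mdist x y < e) -> x = y.
Proof.
move=> H; apply: contrapT => /eqP; rewrite -mdist_gt0 => xy.
by have := H _ xy; rewrite ltxx.
Qed.

Lemma metric_continuousP (f : X -> X) : continuous f <->
  forall x (e : R), 0 < e -> exists2 d, 0 < d &
    forall y, mdist x y < d -> mdist (f x) (f y) < e.
Proof.
split=> [cf x e e0|H x].
  have /nbhs_mdist_lt : nbhs x (f @^-1` [set z | mdist (f x) z < e]).
    by apply: (cf x); apply/nbhs_mdist_lt; exists e.
  by [].
move=> W /nbhs_mdist_lt[e e0 eW]; have [d d0 dH] := H x e e0.
by apply/nbhs_mdist_lt; exists d => // y /dH; exact: eW.
Qed.

Hypothesis cX : compact [set: X].

(* P is the negation of a uniform statement at scale d: a uniform estimate is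
   obtained by refuting P near a limit pair (x, y). *)
Lemma compact_accumulation (P : R -> X -> X -> Prop) :
  (forall d, 0 < d -> exists x y, P d x y) ->
  exists x y, forall e, 0 < e -> exists d x' y',
    [/\ 0 < d < e, mdist x x' < e, mdist y y' < e & P d x' y'].
Proof.
move=> H.
have /choice[u uP] (n : nat) : exists p : X * X, P n.+1%:R^-1 p.1 p.2.
  by have [|x [y Pxy]] := H n.+1%:R^-1; [rewrite invr_gt0|exists (x, y)].
have [|[x y] xyP] := @compact_seq_cluster (X * X)%type u.
  by rewrite -setXTT; exact: compact_setX.
exists x, y => e e0; have [n nP] := archimedean_inv e0.
have [|m [nm /= [? ?]]] := xyP ([set z | mdist x z < e] `*` [set z | mdist y z < e]) _ n.
  exists ([set z | mdist x z < e], [set z | mdist y z < e]) => //=.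
  by split; apply/nbhs_mdist_lt; exists e.
exists m.+1%:R^-1, (u m).1, (u m).2; split=> //.
by rewrite invr_gt0 ltr0n /= nP.
Qed.

Lemma compact_uniform_continuity (f : X -> X) (e : R) :
  continuous f -> 0 < e ->
  exists2 d, 0 < d & forall x y, mdist x y < d -> mdist (f x) (f y) < e.
Proof.
move=> /metric_continuousP cf e0; apply: contrapT => H.
have [d d0|x [y xyP]] := @compact_accumulation
    (fun d x y => mdist x y < d /\ e <= mdist (f x) (f y)).
  apply: contrapT => H'; apply: H; exists d => // x y xy; rewrite ltNge.
  by apply/negP => exy; apply: H'; exists x, y.
have [d d0 dP] := cf x (e / 2) ltac:(lra).
have [t [x' [y' [/andP[t0 td] xx _ [xy]]]]] := xyP (d / 2) ltac:(lra).
have fx : mdist (f x) (f x') < e / 2 by apply: dP; lra.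
have fy : mdist (f x) (f y') < e / 2.
  by apply: dP; have := @metric_triangle _ X x x' y'; lra.
have := @metric_triangle _ X (f x) (f x') (f y').
have := @metric_triangle _ X (f x') (f x) (f y'); rewrite (metric_sym (f x') (f x)).
lra.
Qed.

Lemma compact_bijective_homeomorphism (f : X -> X) :
  continuous f -> injective f -> (forall y, exists x, f x = y) ->
  homeomorphism f.
Proof.
move=> cf inj_f /choice[g gK]; split=> //; exists g.
have fK : cancel f g by move=> x; apply: inj_f; rewrite gK.
split=> //; apply/metric_continuousP => y e e0; apply: contrapT => H.
(* Points far from [g y] whose images tend to [y] accumulate at a point sent to [y], that is, at
   [g y]. The second coordinate is a dummy. *)
have [d d0|x [y0 xP]] := @compact_accumulation
    (fun d x _ => mdist y (f x) < d /\ e <= mdist (g y) x).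
  apply: contrapT => H'; apply: H; exists d => // z yz; rewrite ltNge.
  by apply/negP => eyz; apply: H'; exists (g z), y; rewrite gK.
have fxy : f x = y.
  apply: mdist_eq0_lt => e' e'0.
  have [d d0 dP] := (metric_continuousP f).1 cf x (e' / 2) ltac:(lra).
  have [|t [x' [_ [/andP[t0 td] xx _ [yf _]]]]] := xP (Num.min d (e' / 2)).
    by rewrite lt_min d0; lra.
  move: td xx; rewrite !lt_min => /andP[_ td] /andP[/dP xx _].
  by have := @metric_triangle _ X (f x) (f x') y; rewrite (metric_sym (f x') y); lra.
have [t [x' [_ [_ xx _ [_]]]]] := xP e e0.
by rewrite -fxy fK; lra.
Qed.

End MetricSpace.

Lemma homeomorphism_id (T : topologicalType) : homeomorphism (@id T).
Proof.
by split=> [x|]; [exact: cvg_id|exists id; split=> // x; exact: cvg_id].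
Qed.

Lemma homeomorphism_comp (S T Z : topologicalType) (f : S -> T) (g : T -> Z) :
  homeomorphism f -> homeomorphism g -> homeomorphism (g \o f).
Proof.
move=> [cf [f' [cf' fK f'K]]] [cg [g' [cg' gK g'K]]]; split.
  by move=> x; apply: continuous_comp; [exact: cf|exact: cg].
exists (f' \o g'); split; last 2 first.
- by move=> x /=; rewrite gK fK.
- by move=> x /=; rewrite f'K g'K.
by move=> x; apply: continuous_comp; [exact: cg'|exact: cf'].
Qed.

(** * Slow radial contractions towards a star-shaped set *)

Section DistanceToSet.
Context {R : realType} {V : normedModType R}.
Variable K : set V.
Hypothesis K0 : K !=set0.

Definition set_distance (v : V) : R := inf [set `|v - w| | w in K].

Lemma set_distance_le v w : K w -> set_distance v <= `|v - w|.
Proof.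
move=> Kw; apply: ge_inf; last by exists w.
by exists 0 => _ [u _ <-].
Qed.

Lemma set_distance_ge0 v : 0 <= set_distance v.
Proof.
apply: lb_le_inf => [|_ [w _ <-] //].
by have [w Kw] := K0; exists `|v - w|; exists w.
Qed.

Lemma set_distance_lt v (d : R) :
  set_distance v < d -> exists2 w, K w & `|v - w| < d.
Proof.
move=> vd; have [|_ [w Kw <-] wd] := inf_lt _ vd; last by exists w.
by have [w Kw] := K0; exists `|v - w|; exists w.
Qed.

Lemma set_distance_eq0 v : K v -> set_distance v = 0.
Proof.
move=> Kv; apply/eqP; rewrite eq_le set_distance_ge0 andbT.
by have := set_distance_le v Kv; rewrite subrr normr0.
Qed.

Lemma set_distance_triangle v w : set_distance v <= `|v - w| + set_distance w.
Proof.
apply/ler_addgt0Pr => e e0.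
have [|u Ku wu] := @set_distance_lt w (set_distance w + e); first by lra.
have := set_distance_le v Ku; have := ler_distD w v u; lra.
Qed.

Lemma set_distance_lipschitz v w :
  `|set_distance v - set_distance w| <= `|v - w|.
Proof.
rewrite ler_norml; have := set_distance_triangle v w.
by have := set_distance_triangle w v; rewrite (distrC w v); lra.
Qed.

Hypothesis starK : forall w t, K w -> 0 <= t <= 1 -> K (t *: w).

(** A point [u] of [K] near [v] gives the point [t *: u] of [K], and scaling shortens [v - u]. This
    monotonicity along rays is what makes the contraction injective. *)
Lemma set_distance_scale v t :
  0 <= t <= 1 -> set_distance (t *: v) <= set_distance v.
Proof.
move=> t01; apply/ler_addgt0Pr => e e0.
have [|u Ku vu] := @set_distance_lt v (set_distance v + e); first by lra.
apply: le_trans (set_distance_le _ (starK Ku t01)) _.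
rewrite -scalerBr normrZ ger0_norm; last by case/andP: t01.
case/andP: t01 => t0 t1; have := normr_ge0 (v - u); nra.
Qed.

End DistanceToSet.

(** * Functions that vary by at most one unit along a relation *)

Section SlowFunction.
Context {R : realType}.
Variable rel : R -> R -> Prop.
Hypothesis rel_sym : forall a b, rel a b -> rel b a.
Hypothesis rel_near0 : forall e, 0 < e ->
  exists2 d, 0 < d & forall a b, rel a b -> a < d -> b < e.

(* rel a b means that some other element has points at levels a and b.  The n unit
   steps of mu take place at levels so far apart that no element sees two of
   them. *)
Lemma slow_function (n : nat) (d : R) : 0 < d ->
  exists (mu : R -> R) (L : R),
    [/\ forall s, s <= 0 -> mu s = 0, forall s, d <= s -> mu s = n%:R,
        forall s t, s <= t -> mu s <= mu t,
        0 <= L /\ forall s t, `|mu s - mu t| <= L * `|s - t| &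
        forall a b, rel a b -> `|mu a - mu b| <= 1].
Proof.
elim: n d => [|n IH] d d0.
  exists (fun=> 0), 0; split=> //; first by split=> // s t; rewrite subrr normr0 mul0r.
  by move=> a b _; rewrite subrr normr0.
have [d1 d10 d1P] := rel_near0 (e := d / 2) ltac:(lra).
(* The [n] steps of the induction hypothesis happen below [d2], the new one between [d / 2] and [d].
   A level below [d2] is related only to levels below [d / 2], which the new step does not reach. *)
pose d2 := Num.min d1 (d / 2).
have d20 : 0 < d2 by rewrite /d2 lt_min d10 /=; lra.
have d2d : d2 <= d / 2 by rewrite /d2 ge_min lexx orbT.
have d2P a b : rel a b -> a < d2 -> b < d / 2.
  by move=> ab ad; apply: d1P ab _; apply: lt_le_trans ad _; rewrite ge_min lexx.
have [mu [L [mu0 mun mule [L0 muL] murel]]] := IH d2 d20.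
pose cl s : R := Num.max 0 (Num.min 1 (2 / d * s - 1)).
have i0 : 0 < 2 / d by rewrite divr_gt0.
have id : 2 / d * (d / 2) = 1 by field; lra.
have cl0 s : s <= d / 2 -> cl s = 0.
  move=> sd; apply/max_idPl; rewrite ge_min; apply/orP; right.
  have : 2 / d * s <= 2 / d * (d / 2) by rewrite ler_pM2l.
  by rewrite id; lra.
have cl1 s : d <= s -> cl s = 1.
  move=> sd; rewrite /cl (_ : Num.min _ _ = 1) ?max_r //.
  by apply/min_idPl; nra.
have clP s : [\/ 2 / d * s - 1 <= 0 /\ cl s = 0,
    0 <= 2 / d * s - 1 <= 1 /\ cl s = 2 / d * s - 1 |
    1 <= 2 / d * s - 1 /\ cl s = 1].
  rewrite /cl; set x := _ - 1.
  have [x1|x1] := leP 1 x; first by constructor 3; rewrite max_r.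
  have [x0|x0] := leP 0 x; first by constructor 2; rewrite ltW.
  by constructor 1; rewrite ltW.
have clD s t : s <= t -> 0 <= cl t - cl s <= 2 / d * (t - s).
  move=> st; have : 2 / d * s <= 2 / d * t by rewrite ler_pM2l.
  rewrite mulrBr; case: (clP s) => -[+ ->]; case: (clP t) => -[+ ->]; lra.
have clle s t : s <= t -> cl s <= cl t.
  by move=> /clD/andP[]; rewrite subr_ge0.
have clL s t : `|cl s - cl t| <= 2 / d * `|s - t|.
  wlog st : s t / s <= t => [H|].
    have [/H //|/ltW/H] := leP s t; by rewrite distrC (distrC s).
  rewrite !(distrC s) (distrC (cl s)) !ger0_norm ?subr_ge0 ?clle //.
  by have /andP[] := clD _ _ st.
have cl01 s : 0 <= cl s <= 1.
  by rewrite le_max lexx /= ge_max ler01 /= ge_min lexx.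
exists (fun s => mu s + cl s), (L + 2 / d); split.
- by move=> s s0; rewrite mu0 // cl0 ?addr0 //; lra.
- by move=> s sd; rewrite mun ?cl1 -?natr1 //; lra.
- by move=> s t st; rewrite lerD ?mule ?clle.
- split=> [|s t]; first lra.
  rewrite opprD addrACA mulrDl; apply: le_trans (ler_normD _ _) _.
  by rewrite lerD.
- move=> a b ab.
  have [ad|ad] := ltP a d2.
    have bd := d2P _ _ ab ad.
    by rewrite !cl0 ?addr0 ?murel //; lra.
  have [bd|bd] := ltP b d2.
    have ad' := d2P _ _ (rel_sym ab) bd.
    by rewrite !cl0 ?addr0 ?murel //; lra.
  (* Both levels are at least [d2], where [mu] is constant, so only the new step counts. *)
  rewrite !mun // opprD addrACA subrr add0r ler_norml.
  by have := cl01 a; have := cl01 b; lra.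
Qed.

End SlowFunction.

(** * The radial contraction with variable ratio *)

Section RadialContraction.
Context {R : realType} {V : normedModType R}.
Variables (m : V -> R) (r k L : R).
Hypotheses (r0 : 0 < r) (k0 : 0 < k) (L0 : 0 <= L).
Hypothesis m_ge : forall v, k <= m v.
Hypothesis m_le1 : forall v, m v <= 1.
Hypothesis m_scale : forall v t, 0 <= t <= 1 -> m (t *: v) <= m v.
Hypothesis m_lip : forall v w, `|m v - m w| <= L * `|v - w|.

(* ball_ratio v *: v is the radial retraction of v onto the ball of radius r. *)
Definition ball_ratio (v : V) : R := r / Num.max r `|v|.

Definition contraction_ratio (v : V) : R := m v + (1 - m v) * ball_ratio v.

Definition radial_contraction (v : V) : V := contraction_ratio v *: v.

Local Notation g := radial_contraction.

Let max_gt0 (v : V) : 0 < Num.max r `|v|.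
Proof. by rewrite lt_max r0. Qed.

Let m_ge0 v : 0 <= m v.
Proof. exact: le_trans (ltW k0) (m_ge v). Qed.

Lemma ball_ratio_le1 v : 0 < ball_ratio v <= 1.
Proof.
by rewrite divr_gt0 //= ler_pdivrMr // mul1r le_max lexx.
Qed.

Lemma ball_ratio_norm v : ball_ratio v * `|v| = Num.min r `|v|.
Proof.
rewrite /ball_ratio; have [rv|rv] := leP r `|v|.
  by rewrite divfK ?gt_eqF //; apply: lt_le_trans rv.
by rewrite divff ?mul1r ?gt_eqF //; lra.
Qed.

(** One half of the bound comes from moving the vector at a fixed ratio, the other from the change
    of ratio, whose factor of norm [w] is absorbed by the denominator of [ball_ratio w]. *)
Lemma ball_ratio_lipschitz v w :
  `|ball_ratio v *: v - ball_ratio w *: w| <= 2 * `|v - w|.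
Proof.
have -> : ball_ratio v *: v - ball_ratio w *: w =
    ball_ratio v *: (v - w) + (ball_ratio v - ball_ratio w) *: w.
  by rewrite scalerBr scalerBl addrA subrK.
apply: le_trans (ler_normD _ _) _.
rewrite (normrZ (ball_ratio v)) (normrZ (_ - _)).
have /andP[a0 a1] := ball_ratio_le1 v.
suff : `|ball_ratio v - ball_ratio w| * `|w| <= `|v - w|.
  rewrite (gtr0_norm a0); have := normr_ge0 (v - w); nra.
have vw : `|Num.max r `|w| - Num.max r `|v| | <= `|v - w|.
  apply: le_trans (ler_dist_dist v w); move: `|v| `|w| => a b.
  have := ler_norm (a - b); have := ler_norm (b - a); rewrite (distrC b).
  by rewrite ler_norml; case: (leP r a) => ?; case: (leP r b) => ?; lra.
have -> : ball_ratio v - ball_ratio w =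
    ball_ratio v * (Num.max r `|w| - Num.max r `|v|) / Num.max r `|w|.
  rewrite /ball_ratio; field.
  by rewrite !gt_eqF.
rewrite normrM normrM [`|ball_ratio v|]gtr0_norm // [`|_^-1|]gtr0_norm ?invr_gt0 //.
have aux (b q M x : R) : 0 < b <= 1 -> 0 <= q -> 0 < M -> 0 <= x <= M ->
    b * q / M * x <= q.
  move=> /andP[b0 b1] q0 M0 /andP[x0 xM]; rewrite mulrAC ler_pdivrMr //.
  have : b * x <= M by nra.
  nra.
apply: le_trans vw; apply: aux => //; first by rewrite a0.
by rewrite normr_ge0 le_max lexx orbT.
Qed.

Lemma contraction_ratio_bounds v :
  [/\ m v <= contraction_ratio v, 0 < contraction_ratio v & contraction_ratio v <= 1].
Proof.
have aux (x b : R) : 0 < x -> x <= 1 -> 0 < b <= 1 ->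
    [/\ x <= x + (1 - x) * b, 0 < x + (1 - x) * b & x + (1 - x) * b <= 1].
  move=> x0 x1 /andP[b0 b1].
  have : 0 <= (1 - x) * b by rewrite mulr_ge0 //; lra.
  have : 0 <= (1 - x) * (1 - b) by rewrite mulr_ge0 //; lra.
  by split; lra.
by apply: aux; [exact: lt_le_trans (m_ge v)|exact: m_le1|exact: ball_ratio_le1].
Qed.

Lemma radial_contraction_norm v :
  `|g v| = Num.min r `|v| + m v * (`|v| - Num.min r `|v|).
Proof.
have [_ c0 _] := contraction_ratio_bounds v.
rewrite /g normrZ gtr0_norm // /contraction_ratio mulrDl -mulrA ball_ratio_norm.
by ring.
Qed.

Lemma radial_contraction_small v : `|v| <= r -> g v = v.
Proof.
move=> vr; rewrite /g /contraction_ratio /ball_ratio max_l // divff ?gt_eqF //.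
by rewrite mulr1 addrC subrK scale1r.
Qed.

Lemma radial_contraction_id v : m v = 1 -> g v = v.
Proof.
by move=> mv; rewrite /g /contraction_ratio mv subrr mul0r addr0 scale1r.
Qed.

Lemma radial_contraction_norm_ge v : r <= `|v| -> r <= `|g v|.
Proof.
move=> rv; rewrite radial_contraction_norm min_l // lerDl.
by rewrite mulr_ge0 ?subr_ge0 ?m_ge0.
Qed.

Lemma radial_contraction_norm_le v : `|g v| <= r + m v * `|v|.
Proof.
rewrite radial_contraction_norm lerD ?ge_min ?lexx // ler_wpM2l ?m_ge0 //.
by rewrite lerBlDr lerDl le_min normr_ge0 ltW.
Qed.

(** The variation of [m] is kept apart from its Lipschitz constant [L], which may be huge; on the
    sets to be controlled the variation itself is small. *)
Lemma radial_contraction_dist v w :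
  `|g v - g w| <= 2 * `|v - w| + `|m v - m w| * `|w|.
Proof.
set P := fun v => ball_ratio v *: v.
have -> : g v - g w = m v *: (v - w) + (1 - m v) *: (P v - P w) +
    (m v - m w) *: ((1 - ball_ratio w) *: w).
  rewrite /g /P /contraction_ratio; move: (ball_ratio v) (ball_ratio w) => b b'.
  rewrite 2!scalerBr 3!scalerA -!scaleNr addrACA -2!scalerDl -addrA -scalerDl.
  by congr (_ + _ *: _); rewrite /GRing.scale /=; ring.
apply: le_trans (ler_normD _ _) _; apply: lerD.
  apply: le_trans (ler_normD _ _) _; rewrite 2!normrZ.
  have := ball_ratio_lipschitz v w; have := m_le1 v; have := m_ge v.
  rewrite -/(P v) -/(P w) => mk m1 PL.
  rewrite [`|m v|]ger0_norm // [`|1 - m v|]ger0_norm ?subr_ge0 //.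
  have aux (x y z : R) : 0 <= x -> x <= 1 -> 0 <= y -> z <= 2 * y ->
      x * y + (1 - x) * z <= 2 * y.
    by move=> x0 x1 y0 zy; nra.
  exact: aux.
rewrite 2!normrZ; apply: ler_wpM2l => //.
have /andP[b0 b1] := ball_ratio_le1 w.
by rewrite ger0_norm ?subr_ge0 // ler_piMl // lerBlDr lerDl ltW.
Qed.

Lemma radial_contraction_local_lip v w :
  `|g v - g w| <= (2 + L * `|w|) * `|v - w|.
Proof.
apply: le_trans (radial_contraction_dist v w) _.
by rewrite [leRHS]mulrDl lerD2l mulrAC ler_wpM2r.
Qed.

Lemma radial_contraction_continuous : continuous g.
Proof.
move=> w; apply/cvgrPdist_lt => e e0.
have c0 : 0 < 2 + L * `|w| by rewrite ltr_pwDl // mulr_ge0.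
have d0 : 0 < e / (2 + L * `|w|) by rewrite divr_gt0.
apply/nbhs_normP; exists (e / (2 + L * `|w|)) => // v /= vw.
rewrite distrC; apply: le_lt_trans (radial_contraction_local_lip v w) _.
by rewrite mulrC -ltr_pdivlMr // distrC.
Qed.

(** The norm of the image is the part within radius [r] plus [m] times the excess, and [m] is
    positive and nondecreasing along the ray. *)
Lemma radial_contraction_norm_lt w t :
  0 <= t < 1 -> w != 0 -> `|g (t *: w)| < `|g w|.
Proof.
move=> /andP[t0 t1] w0; rewrite 2!radial_contraction_norm.
have aux (a b x y : R) : 0 <= x -> x < y -> 0 < a -> a <= b ->
    Num.min r x + a * (x - Num.min r x) < Num.min r y + b * (y - Num.min r y).
  move=> x0 xy a0 ab; case: (leP r x) => rx; case: (leP r y) => ry; try lra.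
    have : a * (x - r) <= b * (x - r) by rewrite ler_wpM2r //; lra.
    have : b * (x - r) < b * (y - r) by rewrite ltr_pM2l; lra.
    lra.
  have : 0 <= b * (y - r) by rewrite mulr_ge0 //; lra.
  lra.
apply: aux.
- exact: normr_ge0.
- by rewrite normrZ ger0_norm // gtr_pMl // normr_gt0.
- exact: lt_le_trans (m_ge _).
- by apply: m_scale; rewrite t0 ltW.
Qed.

(** Points with equal images are positive multiples of each other, and on a ray the norm of the
    image is strictly increasing. *)
Lemma radial_contraction_inj : injective g.
Proof.
have H v w : g v = g w -> contraction_ratio w <= contraction_ratio v -> v = w.
  move=> gvw cwv; have [w0|w0] := eqVneq w 0.
    have [_ c0 _] := contraction_ratio_bounds v.
    move: gvw; rewrite w0 /g scaler0 => /eqP.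
    by rewrite scaler_eq0 gt_eqF //= => /eqP.
  have [_ cv0 _] := contraction_ratio_bounds v.
  have [_ cw0 _] := contraction_ratio_bounds w.
  pose t := contraction_ratio w / contraction_ratio v.
  have vE : v = t *: w.
    by rewrite /t mulrC -scalerA -/(g w) -gvw /g scalerA mulVf ?gt_eqF // scale1r.
  have t0 : 0 <= t by rewrite divr_ge0 // ltW.
  have [t1|t1] := ltP t 1.
    have := @radial_contraction_norm_lt w t; rewrite t0 t1 -vE gvw ltxx.
    by move=> /(_ isT w0).
  rewrite vE (_ : t = 1) ?scale1r //; apply/eqP; rewrite eq_le t1 andbT.
  by rewrite ler_pdivrMr // mul1r.
move=> v w gvw; have [cw|/ltW cv] := leP (contraction_ratio w) (contraction_ratio v).
  exact: H.
by apply/esym/H.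
Qed.

(** Intermediate values on the ray of [w]: the ratio is at most 1, so [t = 1] falls short of [w],
    and at least [k], so [t = k^-1] reaches it. *)
Lemma radial_contraction_surj w : exists v, g v = w.
Proof.
have [->|w0] := eqVneq w 0; first by exists 0; rewrite /g scaler0.
have nw0 : 0 < `|w| by rewrite normr_gt0.
have k1 : 1 <= k^-1.
  by rewrite invf_ge1 //; apply: le_trans (m_ge 0) (m_le1 0).
pose f (t : R) := `|g (t *: w)|.
have fE t : 0 <= t -> f t = contraction_ratio (t *: w) * t * `|w|.
  move=> t0; have [_ c0 _] := contraction_ratio_bounds (t *: w).
  by rewrite /f /g !normrZ (gtr0_norm c0) ger0_norm // mulrA.
have cg : continuous (fun t : R => g (t *: w)).
  by move=> t; apply: (@continuous_comp _ _ _ (fun t : R => t *: w) g);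
    [exact: scalel_continuous|exact: radial_contraction_continuous].
have cf : {within `[1, k^-1], continuous f}.
  by apply: continuous_subspaceT => t; apply: cvg_norm; exact: cg.
have [|t] := @IVT _ f 1 k^-1 `|w| k1 cf.
  have [_ _ c1] := contraction_ratio_bounds (1 *: w).
  have [c2 _ _] := contraction_ratio_bounds (k^-1 *: w).
  have ki0 : 0 <= k^-1 by rewrite invr_ge0 ltW.
  rewrite ge_min le_max (fE 1) // (fE k^-1) // mulr1.
  apply/andP; split; apply/orP; [left|right].
    by rewrite ler_piMl.
  rewrite ler_peMl // ler_pdivlMr // mul1r.
  exact: le_trans (m_ge _) c2.
rewrite in_itv /= => /andP[t1 _].
have t0 : 0 < t by exact: lt_le_trans t1.
rewrite fE; last exact: ltW.
move=> ft; exists (t *: w).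
rewrite /g scalerA (_ : _ * t = 1) ?scale1r //.
have nz : `|w| != 0 by rewrite gt_eqF.
by apply: (mulIf nz); rewrite mul1r.
Qed.

End RadialContraction.

(** * Shrinking along a starlike chart *)

Section Shrinking.
Context {R : realType} {X : metricType R}.
Implicit Types (x y z : X) (A E W : set X) (C : set (set X)).

(* This is all that is used of nullity; unlike nullity of C it is local at E. *)
Definition small_near E C := forall e : R, 0 < e ->
  exists W, [/\ open W, E `<=` W & forall A, C A -> A `&` W !=set0 ->
    forall x y, A x -> A y -> mdist x y < e].

(** A member that is still large may be left untouched, to be dealt with by a later
    homeomorphism. *)
Definition fixes_or_shrinks (h : X -> X) C (e : R) := forall A, C A ->
  (forall x, A x -> h x = x) \/
  (forall x y, A x -> A y -> mdist (h x) (h y) < e).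

(** [C] is arbitrary so that it can consist of images of elements under homeomorphisms already
    constructed. *)
Definition shrinkable E := forall C W (e : R),
  small_near E C -> open W -> E `<=` W -> 0 < e ->
  exists h : X -> X, [/\ homeomorphism h, forall x, ~ W x -> h x = x,
    forall x y, E x -> E y -> mdist (h x) (h y) < e & fixes_or_shrinks h C e].

Definition shrinkable_towards E0 E1 := forall C W V (e : R),
  small_near E0 C -> open W -> E0 `<=` W -> open V -> E1 `<=` V -> 0 < e ->
  exists h : X -> X, [/\ homeomorphism h, forall x, ~ W x -> h x = x,
    forall x, E0 x -> V (h x) & fixes_or_shrinks h C e].

End Shrinking.

(* phi is the composite of N -> X / E1 with a chart, translated to send E1 to 0. *)
Section StarlikeChart.
Context {R : realType} {X : metricType R} {F : normedModType R}.
Variables (N O E0 E1 : set X) (phi : X -> F) (Q : set F).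
Hypothesis cX : compact [set: X].
Hypotheses (cN : closed N) (oO : open O) (ON : O `<=` N) (E0O : E0 `<=` O).
Hypotheses (cE0 : closed E0) (E10 : E1 `<=` E0) (E1n : E1 !=set0).
Hypothesis phi_cont : forall x, N x -> forall e : R, 0 < e ->
  exists2 d : R, 0 < d &
    forall y, N y -> mdist x y < d -> `|phi x - phi y| < e.
Hypothesis phi_inj : forall x y, N x -> N y -> phi x = phi y ->
  x = y \/ E1 x /\ E1 y.
Hypothesis phi0 : forall x, N x -> E1 x <-> phi x = 0.
Hypotheses (oQ : open Q) (phiE0Q : forall x, E0 x -> Q (phi x)).
Hypothesis Q_phi : forall v, Q v -> exists2 x, N x & phi x = v.
Hypothesis star : forall x (t : R), E0 x -> 0 <= t <= 1 ->
  exists2 y, E0 y & phi y = t *: phi x.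

Let E0N : E0 `<=` N. Proof. by move=> x /E0O/ON. Qed.

Local Notation sd := (set_distance (phi @` E0)).

Let K0 : phi @` E0 !=set0.
Proof. by have [e /E10 Ee] := E1n; exists (phi e); exists e. Qed.

Let sdP v (d : R) : sd v < d -> exists2 x, E0 x & `|v - phi x| < d.
Proof. by move=> /(set_distance_lt K0)[_ [x Ex <-] vx]; exists x. Qed.

Let norm_eq0_lt (v : F) : (forall e : R, 0 < e -> `|v| < e) -> v = 0.
Proof.
move=> H; apply: contrapT => /eqP; rewrite -normr_gt0 => v0.
by have := H _ v0; rewrite ltxx.
Qed.

Let norm_eq_lt (v w : F) :
  (forall e : R, 0 < e -> exists v' w',
     [/\ `|v - v'| < e, `|w - w'| < e & `|v' - w'| < e]) -> v = w.
Proof.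
move=> H; apply/eqP; rewrite -subr_eq0; apply/eqP/norm_eq0_lt => e e0.
have [v' [w' [vv ww vw]]] := H (e / 3) ltac:(lra).
have := ler_distD v' v w; have := ler_distD w' v' w; rewrite (distrC w' w).
lra.
Qed.

(** As [N] is closed and [phi] is continuous on it, limit pairs stay in [N] and their images are
    limits too. *)
Lemma chart_accumulation (P : R -> X -> X -> Prop) :
  (forall d, 0 < d -> exists x y, [/\ N x, N y & P d x y]) ->
  exists x y, [/\ N x, N y & forall e, 0 < e -> exists d x' y',
    [/\ 0 < d < e, N x' /\ N y', mdist x x' < e /\ mdist y y' < e,
        `|phi x - phi x'| < e /\ `|phi y - phi y'| < e & P d x' y']].
Proof.
move=> H; have [//|x [y xyP]] := compact_accumulation cX
  (P := fun d x y => [/\ N x, N y & P d x y]).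
have Nx : N x.
  apply: closed_adherent cN _ => e /xyP[d [x' [y' [_ xx' _ [Nx' _ _]]]]].
  by exists x'.
have Ny : N y.
  apply: closed_adherent cN _ => e /xyP[d [x' [y' [_ _ yy' [_ Ny' _]]]]].
  by exists y'.
exists x, y; split=> // e e0.
have [dx dx0 dxP] := phi_cont Nx e0; have [dy dy0 dyP] := phi_cont Ny e0.
have [|d [x' [y' [/andP[d0]]]]] := xyP (Num.min e (Num.min dx dy)).
  by rewrite !lt_min e0 dx0.
rewrite !lt_min => /and3P[de ddx ddy] /and3P[xe xdx xdy] /and3P[ye ydx ydy].
move=> [Nx' Ny' Pxy]; exists d, x', y'; split=> //; first by rewrite d0.
by split; [exact: dxP|exact: dyP].
Qed.

(** All of [E1] lies over 0, so the inverse of [phi] is controlled only away from 0. Limit points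
    with equal images coincide or both lie in [E1], and [r] excludes the latter. *)
Lemma chart_inverse_uniform (r e : R) : 0 < r -> 0 < e ->
  exists2 d : R, 0 < d & forall y z, N y -> N z -> r <= `|phi z| ->
    `|phi y - phi z| < d -> mdist y z < e.
Proof.
move=> r0 e0; apply: contrapT => H.
have [d d0|y [z [Ny Nz yzP]]] := @chart_accumulation (fun d y z =>
    [/\ r <= `|phi z|, `|phi y - phi z| < d & e <= mdist y z]).
  apply: contrapT => H'; apply: H; exists d => // y z Ny Nz rz yz.
  by rewrite ltNge; apply/negP => eyz; apply: H'; exists y, z.
have yz : phi y = phi z.
  apply: norm_eq_lt => d /yzP[d' [y' [z' [/andP[_ dd'] _ _ [yy zz] [_ yz _]]]]].
  by exists (phi y'), (phi z'); split=> //; apply: lt_trans dd'.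
have [zy|[_ Ez]] := phi_inj Ny Nz yz; last first.
  have z0 := (phi0 Nz).1 Ez.
  have [d' [y' [z' [_ _ _ [_ zz] [rz _ _]]]]] := yzP r r0.
  by move: zz; rewrite z0 sub0r normrN ltNge rz.
have [d' [y' [z' [_ _ [yy zz] _ [_ _]]]]] := yzP (e / 2) ltac:(lra).
move: yy zz; rewrite zy => yy zz; have := @metric_triangle _ X y' z z'.
rewrite (metric_sym y' z); lra.
Qed.

(** A limit point at level 0 has the same image as a point of [E0], hence lies in [E0], because a
    fibre with several points lies in [E1]. *)
Lemma chart_level_nbhs W : open W -> E0 `<=` W ->
  exists2 d : R, 0 < d & forall x, N x -> sd (phi x) < d -> W x.
Proof.
move=> oW E0W; apply: contrapT => H.
have [d d0|x [y [Nx Ny xyP]]] := @chart_accumulation (fun d x y =>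
    [/\ E0 y, `|phi x - phi y| < d & ~ W x]).
  apply: contrapT => H'; apply: H; exists d => // x Nx /sdP[y Ey xy].
  by apply: contrapT => nW; apply: H'; exists x, y; split=> //; exact: E0N.
have Ey : E0 y.
  apply: closed_adherent cE0 _ => d /xyP[_ [_ [y' [_ _ [_ yy] _ [Ey' _ _]]]]].
  by exists y'.
have xy : phi x = phi y.
  apply: norm_eq_lt => d /xyP[d' [x' [y' [/andP[_ dd'] _ _ [xx yy] [_ xy _]]]]].
  by exists (phi x'), (phi y'); split=> //; apply: lt_trans dd'.
have Wx : W x.
  by apply: E0W; have [->//|[/E10]] := phi_inj Nx Ny xy.
have [d d0 dW] := open_mdist_lt oW Wx.
by have [_ [x' [_ [_ _ [/dW xx _] _ [_ _]]]]] := xyP d d0.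
Qed.

(** This makes lifting through [phi] possible: [Q] contains a ball about each point of the image of
    [E0], and compactness makes the radius uniform. *)
Lemma chart_level_onto :
  exists2 d : R, 0 < d & forall v, sd v < d -> exists2 x, N x & phi x = v.
Proof.
apply: contrapT => H.
have [d d0|x [y0 [Nx _ xP]]] := @chart_accumulation (fun d x _ =>
    E0 x /\ exists2 v, `|v - phi x| < d & ~ Q v).
  apply: contrapT => H'; apply: H; exists d => // v /sdP[x Ex vx].
  apply: Q_phi; apply: contrapT => nQ; apply: H'; exists x, x.
  by split; [exact: E0N|exact: E0N|split=> //; exists v].
have Ex : E0 x.
  apply: closed_adherent cE0 _ => d /xP[_ [x' [_ [_ _ [xx _] _ [Ex' _]]]]].
  by exists x'.
have /nbhs_normP[d /= d0 dQ] : nbhs (phi x) Q.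
  by apply: open_nbhs_nbhs; split=> //; exact: phiE0Q.
have [d' [x' [_ [/andP[_ dd] _ _ [xx _] [_ [v vx]]]]]] := xP (d / 2) ltac:(lra).
apply; apply: dQ => /=; have := ler_distD (phi x') (phi x) v.
rewrite (distrC (phi x') v); lra.
Qed.

Lemma chart_uniform_continuity (d : R) : 0 < d ->
  exists2 c : R, 0 < c & forall x y, N x -> N y -> mdist x y < c ->
    `|phi x - phi y| < d.
Proof.
move=> d0; apply: contrapT => H.
have [c c0|x [y [Nx Ny xyP]]] := @chart_accumulation (fun c x y =>
    mdist x y < c /\ d <= `|phi x - phi y|).
  apply: contrapT => H'; apply: H; exists c => // x y Nx Ny xy.
  by rewrite ltNge; apply/negP => dxy; apply: H'; exists x, y.
have xy : x = y.
  apply: mdist_eq0_lt => e e0.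
  have [c [x' [y' [/andP[_ ce] _ [xx yy] _ [xy _]]]]] := xyP (e / 3) ltac:(lra).
  have := @metric_triangle _ X x x' y; have := @metric_triangle _ X x' y' y.
  rewrite (metric_sym y' y); lra.
have [c [x' [y' [_ _ _ [xx yy] [_]]]]] := xyP (d / 2) ltac:(lra).
move: xx yy; rewrite xy => xx yy; have := ler_distD (phi y) (phi x') (phi y').
rewrite (distrC (phi x') (phi y)); lra.
Qed.

Lemma chart_uniform_nbhs : exists2 c : R, 0 < c &
  forall x y, E0 x -> mdist x y < c -> N y.
Proof.
apply: contrapT => H.
have [c c0|x [y xyP]] := compact_accumulation cX (P := fun c x y =>
    [/\ E0 x, mdist x y < c & ~ N y]).
  apply: contrapT => H'; apply: H; exists c => // x y Ex xy.
  by apply: contrapT => nN; apply: H'; exists x, y.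
have Ex : E0 x.
  apply: closed_adherent cE0 _ => d /xyP[_ [x' [_ [_ xx _ [Ex' _ _]]]]].
  by exists x'.
have [d d0 dO] := open_mdist_lt oO (E0O Ex).
have [c [x' [y' [/andP[_ cd] xx _ [_ xy]]]]] := xyP (d / 2) ltac:(lra).
apply; apply/ON/dO; have := @metric_triangle _ X x x' y'; lra.
Qed.

(** Points of low level are so near [E0] that a ball of fixed radius about them stays in [N], where
    [phi] is uniformly continuous. *)
Lemma chart_level_continuity (d : R) : 0 < d ->
  exists2 c : R, 0 < c & forall x y, N x -> sd (phi x) < c -> mdist x y < c ->
    N y /\ `|phi x - phi y| < d.
Proof.
move=> d0; have [c1 c10 c1P] := chart_uniform_continuity d0.
have [c2 c20 c2P] := chart_uniform_nbhs.
pose W := [set x | exists2 w, E0 w & mdist w x < c2 / 2].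
have oW : open W.
  apply: open_from_mdist => x [w Ew wx]; exists (c2 / 2 - mdist w x).
    by rewrite subr_gt0.
  by move=> y xy; exists w => //; have := @metric_triangle _ X w x y; lra.
have [|c3 c30 c3P] := chart_level_nbhs oW.
  by move=> x Ex; exists x => //; rewrite mdistxx divr_gt0.
exists (Num.min c1 (Num.min (c2 / 2) c3)).
  by rewrite !lt_min c10 c30 divr_gt0.
move=> x y Nx; rewrite !lt_min => /and3P[_ _ /(c3P x Nx)[w Ew wx]].
move=> /and3P[xy1 xy2 _].
have Ny : N y.
  by apply: c2P Ew _; have := @metric_triangle _ X w x y; lra.
by split=> //; exact: c1P.
Qed.

Lemma chart_bounded : exists2 M : R, 0 < M & forall x, N x -> `|phi x| <= M.
Proof.
apply: contrapT => H.
have [d d0|x [y0 [Nx _ xP]]] := @chart_accumulation (fun d x _ =>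
    d^-1 < `|phi x|).
  apply: contrapT => H'; apply: H; exists d^-1; first by rewrite invr_gt0.
  by move=> x Nx; rewrite leNgt; apply/negP => dx; apply: H'; exists x, x.
have p0 : 0 < `|phi x| + 1 by rewrite ltr_wpDl.
have [|d [x' [_ [/andP[d0 dd] _ _ [xx _] dx]]]] := xP (Num.min 1 (`|phi x| + 1)^-1).
  by rewrite lt_min ltr01 invr_gt0.
move: dd xx; rewrite !lt_min => /andP[_ dd] /andP[xx _].
have : `|phi x| + 1 < d^-1 by rewrite -[ltLHS]invrK ltf_pV2 // posrE invr_gt0.
have := ler_normB (phi x) (phi x - phi x'); rewrite subKr; lra.
Qed.

Lemma chart_origin_nbhs V : open V -> E1 `<=` V ->
  exists2 r : R, 0 < r & forall x, N x -> `|phi x| < r -> V x.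
Proof.
move=> oV EV; apply: contrapT => H.
have [d d0|x [y0 [Nx _ xP]]] := @chart_accumulation (fun d x _ =>
    `|phi x| < d /\ ~ V x).
  apply: contrapT => H'; apply: H; exists d => // x Nx xd.
  by apply: contrapT => nV; apply: H'; exists x, x.
have x0 : phi x = 0.
  apply: norm_eq_lt => e /xP[d [x' [_ [/andP[_ de] _ _ [xx _] [xd _]]]]].
  exists (phi x'), 0; rewrite subrr normr0 subr0; split=> //.
  - exact: le_lt_trans xx.
  - exact: lt_trans de.
have Vx : V x by apply/EV/phi0.
have [d d0 dV] := open_mdist_lt oV Vx.
by have [_ [x' [_ [_ _ [/dV xx _] _ [_]]]]] := xP d d0.
Qed.

Lemma starlike_chart_small_near C (d : R) : small_near E0 C -> 0 < d ->
  exists2 c : R, 0 < c & forall A x y, C A -> A x -> A y -> N x ->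
    sd (phi x) < c -> N y /\ `|phi x - phi y| < d.
Proof.
move=> nC d0; have [c1 c10 c1P] := chart_level_continuity d0.
have [W [oW E0W WP]] := nC _ c10; have [c2 c20 c2P] := chart_level_nbhs oW E0W.
exists (Num.min c1 c2) => [|A x y CA Ax Ay Nx]; first by rewrite lt_min c10.
rewrite lt_min => /andP[xc1 xc2]; apply: c1P => //.
apply: (WP _ CA _ _ _ Ax Ay); exists x; split=> //. by apply: c2P.
Qed.

Let star_scale w (t : R) : (phi @` E0) w -> 0 <= t <= 1 -> (phi @` E0) (t *: w).
Proof. by move=> [x Ex <-] t01; have [y Ey <-] := star Ex t01; exists y. Qed.

(** [m] is a rescaled slow function of the distance to the image of [E0], for the relation pairing
    the levels that one member of [C] meets. *)
Lemma slow_radial_ratio C (k eta c0 : R) :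
  small_near E0 C -> 0 < eta -> 0 < c0 -> 0 < k <= 1 ->
  exists (c L : R) (m : F -> R), [/\ 0 < c <= c0, 0 <= L,
    [/\ forall v, k <= m v, forall v, m v <= 1,
        forall v t, 0 <= t <= 1 -> m (t *: v) <= m v &
        forall v w, `|m v - m w| <= L * `|v - w|],
    (forall v, c <= sd v -> m v = 1) /\ (forall x, E0 x -> m (phi x) = k) &
    forall A x y, C A -> A x -> A y -> N x -> sd (phi x) < c ->
      [/\ N y, `|phi x - phi y| < eta & `|m (phi x) - m (phi y)| <= eta]].
Proof.
move=> nC eta0 c00 /andP[k0 k1].
have [c1 c10 c1P] := starlike_chart_small_near nC eta0.
pose c := Num.min c0 c1.
have c_gt0 : 0 < c by rewrite lt_min c00.
pose rel (a b : R) := exists A x y, [/\ C A, A x /\ A y, N x /\ N y,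
  a = sd (phi x) & b = sd (phi y)].
have rel_sym a b : rel a b -> rel b a.
  by move=> [A [x [y [CA [Ax Ay] [Nx Ny] -> ->]]]]; exists A, y, x.
have rel0 e : 0 < e -> exists2 d, 0 < d & forall a b, rel a b -> a < d -> b < e.
  move=> e0; have [d d0 dP] := starlike_chart_small_near nC (d := e / 2) ltac:(lra).
  exists (Num.min d (e / 2)); first by rewrite lt_min d0 divr_gt0.
  move=> _ _ [A [x [y [CA [Ax Ay] [Nx Ny] -> ->]]]].
  rewrite lt_min => /andP[xd xe]; have [_ xy] := dP _ _ _ CA Ax Ay Nx xd.
  have := set_distance_triangle K0 (phi y) (phi x); rewrite distrC; lra.
have [n nP] := archimedean_inv eta0; have {nP} nP := nP n (leqnn n).
have [mu [L [mu0 mu1 mule [L0 muL] murel]]] := slow_function rel_sym rel0 n.+1 c_gt0.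
have n0 : 0 < n.+1%:R^-1 :> R by rewrite invr_gt0.
have n1 : n.+1%:R^-1 <= 1 :> R by rewrite invf_le1 ?ler1n.
have nn : n.+1%:R^-1 * n.+1%:R = 1 :> R by rewrite mulVf // pnatr_eq0.
(* The [n.+1] unit steps of [mu] raise [m] from [k] to 1, each by [a], which is less than [eta]. *)
pose a := (1 - k) / n.+1%:R.
have a0 : 0 <= a by rewrite mulr_ge0 // ?subr_ge0 // ltW.
have a1 : a <= 1 by rewrite /a; move: n.+1%:R^-1 n0 n1 => q; nra.
have an : a <= n.+1%:R^-1 by rewrite /a; move: n.+1%:R^-1 n0 n1 => q; nra.
have mu_ge0 s : 0 <= s -> 0 <= mu s by move=> /mule; rewrite mu0.
have mu_le s : a * mu s <= 1 - k.
  have : mu s <= n.+1%:R.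
    by rewrite -(mu1 (Num.max s c)) ?le_max ?lexx ?orbT // mule // le_max lexx.
  move=> /(ler_wpM2l a0); rewrite /a -[X in _ <= X]mulrA nn mulr1; exact.
pose m v := k + a * mu (sd v).
have m1 v : c <= sd v -> m v = 1.
  by move=> cv; rewrite /m mu1 // /a -mulrA nn mulr1 addrC subrK.
have m_lip v w : `|m v - m w| <= a * `|mu (sd v) - mu (sd w)|.
  by rewrite /m opprD addrACA subrr add0r -mulrBr normrM ger0_norm.
exists c, L, m; split=> //; first by rewrite c_gt0 ge_min lexx.
- split.
  + by move=> v; rewrite lerDl mulr_ge0 // mu_ge0 // set_distance_ge0.
  + by move=> v; rewrite -lerBrDl.
  + move=> v t t01; rewrite lerD2l ler_wpM2l // mule //.
    exact: set_distance_scale K0 star_scale _ _ t01.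
  + move=> v w; apply: le_trans (m_lip v w) _; apply: le_trans (ler_piMl _ a1) _ => //.
    by apply: le_trans (muL _ _) _; rewrite ler_wpM2l // set_distance_lipschitz.
- split=> // x Ex; rewrite /m mu0 ?mulr0 ?addr0 // set_distance_eq0 //.
- move=> A x y CA Ax Ay Nx xc; have [|Ny xy] := c1P _ _ _ CA Ax Ay Nx.
    by apply: lt_le_trans xc _; rewrite ge_min lexx orbT.
  split=> //; apply: le_trans (m_lip _ _) _; apply: le_trans (ltW nP).
  apply: le_trans an; rewrite ler_piMr // murel //.
  by exists A, x, y.
Qed.

(** The homeomorphism is the radial contraction lifted through [phi]; on the image of [E0] its ratio
    [m] is so small that [E0] ends near 0, hence in [V]. *)
Lemma starlike_chart_shrinkable_towards : shrinkable_towards E0 E1.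
Proof.
move=> C W V e nC oW E0W oV E1V e0.
have [r0 r00 r0P] := chart_origin_nbhs oV E1V.
pose r := r0 / 3; have r_gt0 : 0 < r by rewrite divr_gt0.
have [M M0 MP] := chart_bounded.
have [eta eta0 etaP] := @chart_inverse_uniform r (e / 2) r_gt0 ltac:(lra).
have [c1 c10 c1P] := chart_level_nbhs (openI oW oO) (fun x Ex => conj (E0W x Ex) (E0O Ex)).
have [c2 c20 c2P] := chart_level_onto.
(* With [k * M] at most [r], points of [E0] end at norm at most [r + r], below [r0 = 3 * r]. *)
pose k := r / (r + M).
have k01 : 0 < k <= 1.
  by rewrite divr_gt0 ?addr_gt0 //= ler_pdivrMr ?addr_gt0 // mul1r lerDl ltW.
have kM : k * M <= r.
  by rewrite /k mulrAC ler_pdivrMr ?addr_gt0 // ler_wpM2l ?lerDr // ltW.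
(* If [phi] and [m] vary by at most this, [radial_contraction_dist] bounds the variation of [g] by
   [eta / 2]. *)
have e10 : 0 < eta / (2 + M) / 2 by rewrite !divr_gt0 ?addr_gt0.
have c120 : 0 < Num.min c1 c2 by rewrite lt_min c10.
have [c [L [m [/andP[c0]]]]] := slow_radial_ratio nC e10 c120 k01.
rewrite le_min => /andP[cc1 cc2] L0 [m_ge m_le m_scale m_lip] [m1 mk] mC.
have k0 : 0 < k by case/andP: k01.
pose g := radial_contraction m r.
have g_small v : `|v| <= r -> g v = v by exact: radial_contraction_small.
have g_far v : c <= sd v -> g v = v by move=> /m1; exact: radial_contraction_id.
have g_inj : injective g by exact: (@radial_contraction_inj _ _ m r k).
have g_surj v : exists w, g w = v.
  exact: (@radial_contraction_surj _ _ m r k L).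
have g_cont v d : 0 < d -> exists2 a : R, 0 < a &
    forall w, `|v - w| < a -> `|g v - g w| < d.
  move=> d0.
  have /(_ v) gv := @radial_contraction_continuous _ _ m r k L r_gt0 k0 L0 m_ge m_le m_lip.
  have : \forall w \near v, `|g v - g w| < d by exact: (cvgrPdist_lt _ _).1 gv _ d0.
  move=> /nbhs_normP[a a0 aP].
  by exists a => // w vw; exact: aP.
have g_sd v : sd v < c -> sd (g v) < c.
  apply: le_lt_trans; apply: set_distance_scale K0 star_scale _ _ _.
  have [_ g0 ->] := @contraction_ratio_bounds _ _ m r k r_gt0 k0 m_ge m_le v.
  by rewrite andbT ltW.
have psiP v : exists x, sd v < c -> N x /\ phi x = v.
  have [e' _] := E1n; have [vc|vc] := ltP (sd v) c; last by exists e'.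
  by have [|x Nx xv] := c2P v; [exact: lt_le_trans cc2|exists x].
have {psiP} [psi psiP] := choice psiP.
pose S x := N x /\ sd (phi x) < c.
(* [psi] picks an arbitrary point over 0, so the lift is used only beyond radius [r]; within it [g]
   is the identity and [T] can be too. *)
pose T x := if pselect (S x /\ r < `|phi x|) then psi (g (phi x)) else x.
have T_id x : ~ (S x /\ r < `|phi x|) -> T x = x.
  by rewrite /T; case: pselect.
have TN x : N x -> N (T x) /\ phi (T x) = g (phi x).
  move=> Nx; rewrite /T; case: pselect => [Sx|nS] /=.
    by case: Sx => -[_ /g_sd/psiP].
  split=> //; have [xr|xr] := leP `|phi x| r; first by rewrite g_small.
  by have [xc|xc] := ltP (sd (phi x)) c; [case: nS|rewrite g_far].
have TE1 x : E1 x -> T x = x.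
  move=> Ex; apply: T_id => -[[Nx _]].
  by rewrite (phi0 Nx).1 // normr0 => /lt_trans/(_ r_gt0); rewrite ltxx.
have NT x : N (T x) -> N x.
  by move=> NTx; apply: contrapT => nN; move: NTx; rewrite T_id // => -[[]].
have T_inj : injective T.
  move=> x y Txy; have [Nx|nN] := pselect (N x); last first.
    have nNy : ~ N y by move=> /TN[]; rewrite -Txy => /NT.
    by move: Txy; rewrite !T_id // => -[[]].
  have Ny : N y by apply: NT; rewrite -Txy; exact: (TN x Nx).1.
  have pxy : phi x = phi y.
    by apply: g_inj; rewrite -(TN x Nx).2 -(TN y Ny).2 Txy.
  have [//|[Ex Ey]] := phi_inj Nx Ny pxy.
  by rewrite -(TE1 x Ex) Txy TE1.
have T_surj y : exists x, T x = y.
  have [[Ny yc]|nS] := pselect (S y); last by exists y; rewrite T_id // => -[].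
  have [v gv] := g_surj (phi y).
  have vc : sd v < c.
    rewrite ltNge; apply/negP => cv; move: yc; rewrite -gv g_far //.
    by rewrite ltNge cv.
  have [Nx xv] := psiP v vc; have [NTx pTx] := TN _ Nx.
  have [|<-|[_ Ey]] := phi_inj NTx Ny; first by rewrite pTx xv.
    by exists (psi v).
  by exists y; exact: TE1.
have T_cont : continuous T.
  apply/metric_continuousP => x d d0; have [Nx|nN] := pselect (N x); last first.
    have [b b0 bP] := open_mdist_lt (closed_openC cN) nN.
    exists (Num.min b d) => [|y]; first by rewrite lt_min b0.
    by rewrite lt_min => /andP[/bP nNy xy]; rewrite !T_id // => -[[]].
  have [NTx pTx] := TN _ Nx.
  (* Over 0 the inverse of the chart is not controlled, but there [x] lies in [E1] and [T] is the
     identity nearby. *)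
  have [p0|/eqP p0] := pselect (phi (T x) = 0).
    have Ex : E1 x.
      apply/(phi0 Nx)/g_inj; rewrite -pTx p0 g_small // normr0; exact: ltW.
    have [b b0 bP] := open_mdist_lt oO (E0O (E10 Ex)).
    have [b' b'0 b'P] := phi_cont Nx r_gt0.
    exists (Num.min d (Num.min b b')) => [|y]; first by rewrite !lt_min d0 b0.
    rewrite !lt_min => /and3P[xy /bP Oy xb']; rewrite TE1 // T_id // => -[[Ny _]].
    have := b'P y Ny xb'; rewrite (phi0 Nx).1 // sub0r normrN => yr ry.
    by have := lt_trans yr ry; rewrite ltxx.
  rewrite -normr_gt0 in p0.
  have [d1 d10 d1P] := chart_inverse_uniform p0 d0.
  have [d2 d20 d2P] := g_cont (phi x) _ d10.
  have [d3 d30 d3P] := phi_cont Nx d20.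
  have d123 y : N y -> mdist x y < d3 -> mdist (T x) (T y) < d.
    move=> Ny xy; have [NTy pTy] := TN _ Ny; rewrite metric_sym.
    apply: d1P => //; rewrite pTx pTy distrC; apply: d2P; exact: d3P.
  have [xc|cx] := ltP (sd (phi x)) c.
    have [_ Ox] := c1P x Nx (lt_le_trans xc cc1).
    have [b b0 bP] := open_mdist_lt oO Ox.
    exists (Num.min d3 b) => [|y]; first by rewrite lt_min d30.
    by rewrite lt_min => /andP[xy /bP/ON Ny]; exact: d123.
  (* Here [x] may lie on the frontier of [N]; neighbours outside [N] are fixed, and so is [x]. *)
  exists (Num.min d3 d) => [|y]; first by rewrite lt_min d30.
  rewrite lt_min => /andP[xy3 xyd]; have [Ny|nN] := pselect (N y); first exact: d123.
  rewrite (T_id x) ?(T_id y) //; first by move=> [[]].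
  by move=> [[_]]; rewrite ltNge cx.
exists T; split.
- exact: compact_bijective_homeomorphism.
- move=> x nW; apply: T_id => -[[Nx xc] _].
  by have [] := c1P x Nx (lt_le_trans xc cc1).
- move=> x Ex; have Nx := E0N Ex; have [NTx pTx] := TN _ Nx.
  apply: r0P => //; rewrite pTx.
  apply: le_lt_trans (@radial_contraction_norm_le _ _ m r k r_gt0 k0 m_ge m_le _) _.
  rewrite mk //; have := ler_wpM2l (ltW k0) (MP x Nx).
  rewrite /r in kM *; lra.
- move=> A CA; have [fixA|] := pselect (forall x, A x -> T x = x); first by left.
  (* A moved point [x] lies in [S] beyond radius [r]. On [A] both [phi] and [m] are almost constant,
     so [T] keeps [A] within [e / 2] of [T x]. *)
  move=> /existsNP[x /not_implyP[Ax Tx]]; right.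
  have [[Nx xc] rx] : S x /\ r < `|phi x| by apply: contrapT => /T_id.
  have near_x y : A y -> mdist (T y) (T x) < e / 2.
    move=> Ay; have [Ny xy mxy] := mC A x y CA Ax Ay Nx xc.
    have [NTx pTx] := TN _ Nx; have [NTy pTy] := TN _ Ny.
    apply: etaP => //; rewrite pTx ?pTy.
      by apply: (@radial_contraction_norm_ge _ _ m r k); rewrite ?(ltW rx).
    apply: le_lt_trans (@radial_contraction_dist _ _ m r k r_gt0 k0 m_ge m_le _ _) _.
    rewrite distrC [`|m _ - _|]distrC.
    have M2 : 0 < 2 + M by rewrite addr_gt0.
    have := ler_pM (normr_ge0 _) (normr_ge0 _) mxy (MP x Nx).
    have : eta / (2 + M) / 2 * (2 + M) = eta / 2 by field; rewrite gt_eqF.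
    lra.
  move=> y z Ay Az; have := near_x y Ay; have := near_x z Az.
  have := @metric_triangle _ X (T y) (T x) (T z); rewrite (metric_sym (T x)).
  lra.
Qed.

End StarlikeChart.

(** * Bing's shrinking criterion *)

Section BingShrinking.
Context {R : realType} {X : metricType R} {Y : topologicalType}.
Variables (pi : X -> Y) (d : Y -> Y -> R) (U : set X).
Hypotheses (cX : compact [set: X]) (pi_cont : continuous pi).
Hypothesis pi_surj : forall y, exists x, pi x = y.
Hypothesis dY : compatible_metric d.
Hypothesis shrink : forall e tau : R, 0 < e -> 0 < tau ->
  exists G : X -> X, [/\ homeomorphism G, forall x, ~ U x -> G x = x,
    forall x, d (pi x) (pi (G x)) < tau &
    forall x y, pi x = pi y -> mdist (G x) (G y) < e].

Let d_ge0 : forall y z, 0 <= d y z. Proof. by case: dY. Qed.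
Let d_eq0 : forall y z, d y z = 0 <-> y = z. Proof. by case: dY. Qed.
Let dC : forall y z, d y z = d z y. Proof. by case: dY. Qed.
Let d_tri : forall y z t, d y t <= d y z + d z t. Proof. by case: dY. Qed.
Let d_nbhs : forall y A, nbhs y A <->
  exists2 e : R, 0 < e & [set z | d y z < e] `<=` A. Proof. by case: dY. Qed.

Let dyy y : d y y = 0. Proof. exact/d_eq0. Qed.

Let d_eq_lt y z : (forall e : R, 0 < e -> d y z < e) -> y = z.
Proof.
move=> H; apply/d_eq0/eqP; rewrite eq_le d_ge0 andbT.
by apply/ler_addgt0Pr => e e0; rewrite add0r ltW ?H.
Qed.

Let cont_d (q : X -> Y) : continuous q -> forall x (e : R), 0 < e ->
  exists2 a, 0 < a & forall y, mdist x y < a -> d (q x) (q y) < e.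
Proof.
move=> cq x e e0; apply/nbhs_mdist_lt.
by apply: (cq x [set z | d (q x) z < e]); apply/d_nbhs; exists e.
Qed.

(** Take [H'] to be [H] followed by the inverse of a shrinking [G]: points with equal images under
    [pi \o H'] have close images under [H], hence are close by uniform continuity of its inverse. *)
Lemma perturb_to_small_fibres (H : X -> X) (e tau : R) :
  homeomorphism H -> (forall x, ~ U x -> H x = x) -> 0 < e -> 0 < tau ->
  exists H' : X -> X, [/\ homeomorphism H', forall x, ~ U x -> H' x = x,
    forall x, d (pi (H x)) (pi (H' x)) < tau &
    forall x y, pi (H' x) = pi (H' y) -> mdist x y < e].
Proof.
move=> [cH [H1 [cH1 HK H1K]]] HU e0 tau0.
have [a a0 aP] := compact_uniform_continuity cX cH1 e0.
have [G [[cG [G1 [cG1 GK G1K]]] GU Gtau Ga]] := shrink a0 tau0.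
exists (G1 \o H); split.
- apply: (@homeomorphism_comp _ _ _ H G1).
    by split=> //; exists H1.
  by split=> //; exists G.
- by move=> x nU /=; rewrite HU // -{1}(GU x nU) GK.
- by move=> x /=; rewrite -{1}(G1K (H x)) dC.
- by move=> x y /= /Ga; rewrite !G1K => /aP; rewrite !HK.
Qed.

Lemma small_fibres_modulus (q : X -> Y) (e : R) : continuous q ->
  (forall x y, q x = q y -> mdist x y < e) ->
  exists2 a : R, 0 < a & forall x y, d (q x) (q y) < a -> mdist x y < e.
Proof.
move=> cq qe; apply: contrapT => H.
have [a a0|x [y xyP]] := compact_accumulation cX (P := fun a x y =>
    d (q x) (q y) < a /\ e <= mdist x y).
  apply: contrapT => H'; apply: H; exists a => // x y xy.
  by rewrite ltNge; apply/negP => exy; apply: H'; exists x, y.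
have : mdist x y < e.
  apply/qe/d_eq_lt => c c0.
  have [a a0 aP] := cont_d cq x (e := c / 3) ltac:(lra).
  have [b b0 bP] := cont_d cq y (e := c / 3) ltac:(lra).
  have [|t [x' [y' []]]] := xyP (Num.min (c / 3) (Num.min a b)).
    by rewrite !lt_min a0 b0 divr_gt0.
  rewrite !lt_min => /and4P[_ tc _ _] /and3P[_ /aP xx _] /and3P[_ _ /bP yy] [xy _].
  have := d_tri (q x) (q x') (q y); have := d_tri (q x') (q y') (q y).
  rewrite (dC (q y') (q y)); lra.
rewrite ltNge => /negP; apply; apply/ler_addgt0Pr => c c0.
have [t [x' [y' [_ xx yy [_ exy]]]]] := xyP (c / 2) ltac:(lra).
have := @metric_triangle _ X x' x y'; have := @metric_triangle _ X x y y'.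
rewrite (metric_sym x' x); lra.
Qed.

(* Later maps stay eta-close to pi \o H k, so by the last clause the fibres of the
   limit have diameter at most 1 / k for all k: the limit is injective. *)
Lemma bing_sequence (eps : R) : 0 < eps ->
  exists (H : nat -> X -> X) (eta : nat -> R), [/\ H 0%N = id /\ eta 0%N = eps,
    forall k, homeomorphism (H k) /\ forall x, ~ U x -> H k x = x,
    forall k, 0 < eta k /\ eta k.+1 <= eta k / 2,
    forall k x, d (pi (H k x)) (pi (H k.+1 x)) < eta k / 2 &
    forall k x y, d (pi (H k.+1 x)) (pi (H k.+1 y)) < 4 * eta k.+1 ->
      mdist x y < k.+1%:R^-1].
Proof.
move=> eps0.
pose good (p : (X -> X) * R) :=
  [/\ homeomorphism p.1, forall x, ~ U x -> p.1 x = x & 0 < p.2].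
pose next (k : nat) (p p' : (X -> X) * R) := [/\ p'.2 <= p.2 / 2,
  forall x, d (pi (p.1 x)) (pi (p'.1 x)) < p.2 / 2 &
  forall x y, d (pi (p'.1 x)) (pi (p'.1 y)) < 4 * p'.2 -> mdist x y < k.+1%:R^-1].
have /choice[step stepP] (kp : nat * {p | good p}) :
    exists p' : {p | good p}, next kp.1 (sval kp.2) (sval p').
  case: kp => k [[H eta] [/= hH HU eta0]].
  have k0 : 0 < k.+1%:R^-1 :> R by rewrite invr_gt0.
  have eta20 : 0 < eta / 2 by rewrite divr_gt0.
  have [H' [hH' H'U H'd H'e]] := perturb_to_small_fibres hH HU k0 eta20.
  have [a a0 aP] : exists2 a : R, 0 < a & forall x y,
      d (pi (H' x)) (pi (H' y)) < a -> mdist x y < k.+1%:R^-1.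
    apply: (small_fibres_modulus (q := pi \o H')) => //.
    move=> x; apply: (@continuous_comp _ _ _ H' pi); last exact: pi_cont.
    by case: hH' => + _; exact.
  (* A quarter of the modulus [a] accounts for the factor 4 in the last clause; halving [eta] makes
     the later moves summable. *)
  pose p' := (H', Num.min (eta / 2) (a / 4)).
  have gp' : good p' by split=> //=; rewrite lt_min eta20 divr_gt0.
  exists (exist _ p' gp'); split=> //=; first by rewrite ge_min lexx.
  move=> x y xy; apply: aP; apply: lt_le_trans xy _.
  have : Num.min (eta / 2) (a / 4) <= a / 4 by rewrite ge_min lexx orbT.
  lra.
have good0 : good (id, eps) by split=> //; exact: homeomorphism_id.
pose st := fix st (k : nat) : {p | good p} :=
  if k is k'.+1 then step (k', st k') else exist _ (id, eps) good0.
exists (fun k => (sval (st k)).1), (fun k => (sval (st k)).2); split=> //.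
- by move=> k; case: (st k) => p [].
- move=> k; split; first by case: (st k) => p [].
  by have [] := stepP (k, st k).
- by move=> k; have [] := stepP (k, st k).
- by move=> k; have [] := stepP (k, st k).
Qed.

Theorem bing_shrinking (eps : R) : 0 < eps ->
  exists h : X -> Y, [/\ homeomorphism h, forall x, ~ U x -> h x = pi x &
    forall x, d (h x) (pi x) <= eps].
Proof.
move=> eps0; have [H [eta [[H0 eta_0] hH etaP stepd stepe]]] := bing_sequence eps0.
pose q k x := pi (H k x).
have cq k : continuous (q k).
  move=> x; apply: (@continuous_comp _ _ _ (H k) pi); last exact: pi_cont.
  by have [[+ _] _] := hH k; exact.
have qd j k x : d (q k x) (q (k + j)%N x) < eta k.
  elim: j k => [|j IH] k; first by rewrite addn0 dyy; case: (etaP k).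
  rewrite addnS -addSn; have := d_tri (q k x) (q k.+1 x) (q (k.+1 + j)%N x).
  have := IH k.+1; have := stepd k x; rewrite -/(q k x) -/(q k.+1 x).
  have [_] := etaP k; lra.
have eta_lim (e : R) : 0 < e -> exists n, forall k, (n <= k)%N -> eta k < e.
  move=> e0; have [n nP] := archimedean_inv (divr_gt0 e0 eps0).
  (* Halving is at least as fast as passing from [1 / k.+1] to [1 / k.+2]. *)
  have etak k : eta k <= eps * k.+1%:R^-1.
    elim: k => [|k IH]; first by rewrite eta_0 invr1 mulr1.
    have [_ etak] := etaP k; apply: le_trans etak _.
    apply: le_trans (ler_wpM2r _ IH) _; first by rewrite invr_ge0.
    rewrite -mulrA ler_pM2l // -invfM lef_pV2 ?posrE ?mulr_gt0 //.
    by rewrite -natrM ler_nat muln2 -addnn addSn ltnS leq_addl.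
  exists n => k /nP; rewrite ltr_pdivlMr // mulrC => ke; exact: le_lt_trans (etak k) ke.
have cY : compact [set: Y].
  have -> : [set: Y] = pi @` [set: X].
    by apply/seteqP; split=> y // _; have [x <-] := pi_surj y; exists x.
  by apply: continuous_compact => //; exact: continuous_subspaceT.
(* From index [k] on the sequence stays within [eta k] of [q k x], hence so does a cluster point,
   which exists by compactness of [Y]. *)
have /choice[h hP] x : exists y, forall k, d (q k x) y <= eta k.
  have [y yP] := compact_seq_cluster (q^~ x) cY.
  exists y => k; apply/ler_addgt0Pr => e e0.
  have [|m [km ym]] := yP [set z | d y z < e] _ k; first by apply/d_nbhs; exists e.
  have := qd (m - k)%N k x; rewrite subnKC // => kmd.
  have := d_tri (q k x) (q m x) y; rewrite (dC (q m x)); move: ym => /=; lra.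
(* Replacing [h] by [q k.+1] costs [eta k.+1] at each point, whence 4 in [bing_sequence]. The bound
   gives injectivity and a continuous inverse. *)
have h_small k x y : d (h x) (h y) < 2 * eta k.+1 -> mdist x y < k.+1%:R^-1.
  move=> xy; apply: stepe; have := hP x k.+1; have := hP y k.+1.
  have := d_tri (q k.+1 x) (h x) (q k.+1 y).
  have := d_tri (h x) (h y) (q k.+1 y); rewrite (dC (h y)).
  by rewrite /q; lra.
have h_inj : injective h.
  move=> x y hxy; apply: mdist_eq0_lt => e /archimedean_inv[n /(_ n (leqnn n))].
  apply: lt_trans; apply: h_small; rewrite hxy dyy mulr_gt0 //.
  by have [] := etaP n.+1.
have h_cont : continuous h.
  move=> x W /d_nbhs[e e0 eW].
  have [n /(_ n (leqnn n)) ne] := eta_lim (e / 3) ltac:(lra).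
  have [a a0 aP] := cont_d (cq n) x (e := e / 3) ltac:(lra).
  apply/nbhs_mdist_lt; exists a => // y /aP xy; apply: eW => /=.
  have := hP x n; have := hP y n; have := d_tri (h x) (q n x) (h y).
  have := d_tri (q n x) (q n y) (h y); rewrite (dC (h x) (q n x)); lra.
have h_surj y : exists x, h x = y.
  (* Preimages of [y] under the [q k] accumulate at a point that [h] sends to [y], since the [q k]
     converge uniformly to [h]. *)
  have /choice[u uP] k : exists x, q k x = y.
    have [z <-] := pi_surj y; have [[_ [H1 [_ _ HK]]] _] := hH k.
    by exists (H1 z); rewrite /q HK.
  have [x xP] := compact_seq_cluster u cX.
  exists x; apply: d_eq_lt => e e0.
  have [n nP] := eta_lim (e / 2) ltac:(lra).
  have [a a0 aP] := cont_d h_cont x (e := e / 2) ltac:(lra).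
  have [|m [nm /= /aP xm]] := xP [set z | mdist x z < a] _ n.
    by apply/nbhs_mdist_lt; exists a.
  have := d_tri (h x) (h (u m)) y; have := hP (u m) m; rewrite uP dC.
  have := nP m nm; lra.
exists h; split.
- split=> //; have /choice[g gP] := h_surj; exists g.
  have hK : cancel h g by move=> x; apply: h_inj; rewrite gP.
  split=> // y W /nbhs_mdist_lt[e e0 eW].
  have [n /(_ n (leqnn n)) ne] := archimedean_inv e0.
  apply/d_nbhs; exists (2 * eta n.+1) => [|z /= yz].
    by rewrite mulr_gt0 //; have [] := etaP n.+1.
  by apply: eW; apply: lt_trans ne; apply: h_small; rewrite !gP.
- move=> x nU; apply: d_eq_lt => e /eta_lim[n /(_ n (leqnn n))].
  apply: le_lt_trans; have := hP x n; rewrite dC /q.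
  by have [_ ->] := hH n.
- by move=> x; have := hP x 0%N; rewrite /q H0 eta_0 dC.
Qed.

End BingShrinking.

(** * Recursively starlike-equivalent decompositions *)

Section DecompositionMap.
Variables (X : topologicalType) (D : decomposition X).

Lemma decomposition_map_continuous : continuous (decomposition_map D).
Proof. exact: pi_continuous. Qed.

Lemma decomposition_map_surjective (y : decomposition_space D) :
  exists x, decomposition_map D x = y.
Proof. by exists (repr y); exact: reprK. Qed.

Lemma decomposition_map_eq x y :
  decomposition_map D x = decomposition_map D y <->
  x = y \/ exists2 A, elements D A & A x /\ A y.
Proof.
rewrite /decomposition_map; split=> [/eqmodP/asboolP //|H].
by apply/eqmodP/asboolP.
Qed.

End DecompositionMap.

Lemma quotient_by_map_eq (X : topologicalType) (A : set X) x y :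
  quotient_by_map A x = quotient_by_map A y <-> x = y \/ A x /\ A y.
Proof.
rewrite /quotient_by_map decomposition_map_eq; split=> -[->|]; try by left.
  by move=> [_ -> AA]; right.
by move=> AA; right; exists A.
Qed.

Section Recursion.
Context {R : realType} {X : metricType R}.
Implicit Types (E A W : set X).
Hypothesis cX : compact [set: X].

(** The chart of the quotient is read on [X] with its origin moved to 0. Being star-shaped refers to
    no norm, so the sup norm of row vectors serves. *)
Lemma starlike_equivalent_shrinkable_towards E0 E1 e :
  closed E0 -> E1 `<=` E0 -> E1 e ->
  starlike_equivalent_with_origin R (@quotient_by_map X E1 @` E0)
    (@quotient_by_map X E1 e) ->
  shrinkable_towards E0 E1.
Proof.
set q := quotient_by_map E1 => cE0 E10 E1e.
move=> [n [V [f [[cV nV] _ [cf [g [_ gK]]] nfV [_ [_ _ [rho [_ _ fE0]]]]]]]].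
move: nV nfV => /set_nbhsP[W [oW E0W WV]] /set_nbhsP[Q [oQ E0Q QV]].
have cq : continuous q by exact: decomposition_map_continuous.
pose phi x := f (q x) - f (q e).
have E0V x : E0 x -> V (q x) by move=> Ex; apply/WV/E0W; exists x.
have qE1 x : E1 x -> q x = q e by move=> Ex; apply/quotient_by_map_eq; right.
have Ve : V (q e) by exact/E0V/E10.
have phi_eq x y : V (q x) -> V (q y) -> phi x = phi y -> q x = q y.
  by move=> Vx Vy /addIr fxy; rewrite -(gK _ Vx) fxy gK.
have phiE1 x : E1 x -> phi x = 0 by move=> /qE1 xe; rewrite /phi xe subrr.
apply: (@starlike_chart_shrinkable_towards R X _ (q @^-1` V) (q @^-1` W) E0 E1
  phi [set v | Q (v + f (q e))]) => //.
- by apply: preimage_closed => // x _; exact: cq.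
- by move=> x /WV.
- by move=> x Ex; apply: E0W; exists x.
- by exists e.
- move=> x Vx c c0; move/subspace_continuousP: cf => /(_ _ Vx) cf.
  have : \forall z \near within V (nbhs (q x)), `|f (q x) - f z| < c.
    exact: (cvgrPdist_lt _ _).1 cf _ c0.
  move=> /cq/nbhs_mdist_lt[d d0 dP]; exists d => // y Vy xy.
  by rewrite /phi opprB addrA subrK; exact: dP xy Vy.
- by move=> x y Vx Vy /(phi_eq _ _ Vx Vy)/quotient_by_map_eq.
- move=> x Vx; split=> [/phiE1 //|x0].
  have /quotient_by_map_eq xe : q x = q e by apply: phi_eq; rewrite ?x0 ?phiE1.
  by case: xe => [->|[]].
- rewrite (_ : [set v | _] = (fun v => v + f (q e)) @^-1` Q) //.
  apply: open_comp => // v _; apply: continuousD; last exact: cst_continuous.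
  by move=> A.
- by move=> x Ex /=; rewrite /phi subrK; apply: E0Q; exists (q x) => //; exists x.
- move=> v /QV[y Vy yv]; have [x xy] := decomposition_map_surjective y.
  have qxy : q x = y by [].
  by exists x; rewrite /= ?qxy // /phi qxy yv addrK.
- move=> x t Ex /andP[t0 t1].
  have : (f @` (q @` E0)) (f (q x)) by exists (q x) => //; exists x.
  rewrite fE0 => -[xi [s [xi1 /andP[s0 sr] fx]]].
  have : (f @` (q @` E0)) (f (q e) + (t * s) *: xi).
    rewrite fE0; exists xi, (t * s); split=> //.
    by rewrite mulr_ge0 //= (le_trans _ sr) // ler_piMl.
  move=> [_ [y Ey <-] fy]; exists y => //.
  by rewrite /phi fy fx !(addrC (f (q e))) !addrK scalerA.
Qed.

Lemma small_near_subset E E' (C : set (set X)) :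
  E' `<=` E -> small_near E C -> small_near E' C.
Proof.
move=> EE H e /H[W [oW EW WP]]; exists W; split=> //.
exact: subset_trans EW.
Qed.

(** First push [E0] into a thin neighbourhood of [E1], then apply a homeomorphism that makes [E1],
    and with it this neighbourhood, small. *)
Lemma shrinkable_from_towards E0 E1 : E1 `<=` E0 ->
  shrinkable_towards E0 E1 -> shrinkable E1 -> shrinkable E0.
Proof.
move=> E10 H01 H1 C W e nC oW E0W e0.
have e20 : 0 < e / 2 by rewrite divr_gt0.
have [h [hH hW hE hC]] := H1 C W (e / 2) (small_near_subset E10 nC) oW
  (subset_trans E10 E0W) e20.
(* Two points of [V] are compared through points of [E1]: a quarter of [e] at each end and [e / 2]
   between. *)
have [d d0 dP] := compact_uniform_continuity cX hH.1 (divr_gt0 e0 (ltr0n _ 4)).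
pose V := [set x | exists2 z, E1 z & mdist z x < d].
have oV : open V.
  apply: open_from_mdist => x [w Ew wx]; exists (d - mdist w x).
    by rewrite subr_gt0.
  by move=> y xy; exists w => //; have := @metric_triangle _ X w x y; lra.
have E1V : E1 `<=` V by move=> x Ex; exists x => //; rewrite mdistxx.
(* h comes first: its modulus of continuity d prescribes how well t must do. *)
have [t [tH tW tE tC]] := H01 C W V d nC oW E0W oV E1V d0.
exists (h \o t); split.
- exact: homeomorphism_comp.
- by move=> x nW /=; rewrite tW // hW.
- move=> x y /tE[z Ez /dP zx] /tE[w Ew /dP wy] /=; have := hE z w Ez Ew.
  have := @metric_triangle _ X (h (t x)) (h z) (h (t y)).
  have := @metric_triangle _ X (h z) (h w) (h (t y)).
  rewrite (metric_sym (h (t x)) (h z)); lra.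
- move=> A CA; case: (tC A CA) => [tA|tA].
    case: (hC A CA) => [hA|hA]; [left=> x Ax|right=> x y Ax Ay] => /=.
      by rewrite tA // hA.
    by rewrite !tA //; apply: lt_trans (hA _ _ Ax Ay) _; lra.
  right=> x y Ax Ay; apply: lt_trans (dP _ _ (tA _ _ Ax Ay)) _; lra.
Qed.

Lemma shrinkable_set1 (e : X) : shrinkable [set e].
Proof.
move=> C W c _ _ _ c0; exists id; split=> //; first exact: homeomorphism_id.
  by move=> x y -> ->; rewrite mdistxx.
by move=> A _; left.
Qed.

Lemma recursively_starlike_shrinkable (n : nat) E :
  recursively_starlike_equivalent R n E -> shrinkable E.
Proof.
move=> [e [G [[G0 Gn] cG Gsub Gstar]]].
(* Induction on the number [k] of filtration steps down to [G n.+1], the single point [e]. *)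
have Ge k i : (i + k)%N = n.+1 -> G i e /\ shrinkable (G i).
  elim: k i => [|k IH] i.
    by rewrite addn0 => ->; rewrite Gn; split=> //; exact: shrinkable_set1.
  rewrite addnS => -[ik]; have [|Ge shr] := IH i.+1; first by rewrite addSn ik.
  have i_n : (i <= n)%N by rewrite -ik leq_addr.
  split; first exact: Gsub Ge.
  apply: shrinkable_from_towards shr; first exact: Gsub.
  apply: starlike_equivalent_shrinkable_towards Ge (Gstar i i_n).
    by apply: cG; exact: leqW.
  exact: Gsub.
by rewrite -G0; have [] := Ge n.+1 0%N (add0n _).
Qed.

End Recursion.

(** * Shrinking the large elements of a null decomposition *)

Section NullDecomposition.
Context {R : realType} {X : metricType R}.
Variables (D : decomposition X) (U : set X).
Variable d : decomposition_space D -> decomposition_space D -> R.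
Hypotheses (cX : compact [set: X]) (nullD : null_collection (elements D)).
Hypothesis closedD : forall A, elements D A -> closed A.
Hypothesis shrD : forall A, elements D A -> shrinkable A.
Hypothesis oU : open U.
Hypothesis DU : forall A, elements D A -> (forall x, A <> [set x]) -> A `<=` U.
Hypothesis dD : compatible_metric d.

Local Notation pi := (decomposition_map D).

Lemma diameter_ge (A : set X) x y :
  A x -> A y -> ((mdist x y)%:E <= diameter A)%E.
Proof. by move=> Ax Ay; apply: ereal_sup_ubound; exists x => //; exists y. Qed.

(** Remove the finitely many other elements of diameter above [e / 2]; they are closed and disjoint
    from [A]. *)
Lemma null_small_near A : elements D A ->
  small_near A (elements D `\ A).
Proof.
move=> DA e e0; have e20 : 0 < e / 2 by rewrite divr_gt0.
have fin := nullD e20; set B := [set _ | _] in fin.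
exists (~` \bigcup_(A' in B `\ A) A'); split.
- apply/closed_openC/closed_bigcup; first exact: finite_setD.
  by move=> A' [[DA' _] _]; exact: closedD.
- move=> x Ax [A' [[DA' _] nA] A'x]; apply: nA.
  by apply: (elements_disjoint DA' DA); exists x.
- move=> A' [DA' nA] [x [A'x nB]] y z A'y A'z; rewrite ltNge; apply/negP => eyz.
  apply: nB; exists A' => //; split=> //; split=> //.
  apply: lt_le_trans (diameter_ge A'y A'z); rewrite lte_fin; lra.
Qed.

Lemma shrink_finitely_many (s : seq (set X)) (e tau : R) : 0 < e -> 0 < tau ->
  (forall A, A \in s -> elements D A /\ A `<=` U) ->
  exists G : X -> X, [/\ homeomorphism G, forall x, ~ U x -> G x = x,
    forall x, d (pi x) (pi (G x)) < tau,
    forall A, A \in s -> forall x y, A x -> A y -> mdist (G x) (G y) < e &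
    fixes_or_shrinks G (elements D) e].
Proof.
have [d_ge0 d_eq0 dC d_tri d_nbhs] := dD.
have dyy y : d y y = 0 by apply/d_eq0.
move=> e0; elim: s tau => [|A s IH] tau tau0 sD.
  exists id; split=> //; first exact: homeomorphism_id.
    by move=> x; rewrite dyy.
  by move=> A _; left.
have tau20 : 0 < tau / 2 by rewrite divr_gt0.
have tau40 : 0 < tau / 4 by rewrite divr_gt0.
have [|G [hG GU Gtau Gs GD]] := IH _ tau20.
  by move=> A' A's; apply: sD; rewrite inE A's orbT.
have [DA AU] : elements D A /\ A `<=` U by apply: sD; rewrite inE eqxx.
(* If [G] already makes [A] small it serves as it is; otherwise it fixes [A] pointwise and [A] is
   still in place. *)
have [fixA|smallA] := GD A DA; last first.
  exists G; split=> //; first by move=> x; apply: lt_trans (Gtau x) _; lra.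
  by move=> A'; rewrite inE => /orP[/eqP ->|/Gs].
have [cG [G1 [cG1 GK G1K]]] := hG.
(* The next homeomorphism acts after [G], so it has to control the images of the other elements
   under [G]. *)
pose C := [set G @` B | B in elements D `\ A].
(* [pi] sends [A] to one point, so two points of [W] have images less than [tau / 2] apart. *)
pose W := U `&` [set x | exists2 a, A a & d (pi a) (pi x) < tau / 4].
have nC : small_near A C.
  move=> c c0; have [b b0 bP] := compact_uniform_continuity cX cG c0.
  have [W' [oW' AW' W'P]] := null_small_near DA b0.
  exists (G1 @^-1` W'); split.
  - by apply: open_comp => // x _; exact: cG1.
  - by move=> x Ax /=; rewrite -(fixA x Ax) GK; exact: AW'.
  - move=> _ [B DB <-] [_ [[x Bx <-]]] /=; rewrite GK => W'x.
    move=> _ _ [y By <-] [z Bz <-]; apply: bP; apply: (W'P B) => //.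
    by exists x.
have oW : open W.
  apply: openI => //; apply: open_from_mdist => x [a Aa ax].
  have /nbhs_mdist_lt[b b0 bP] : nbhs x (pi @^-1` [set z | d (pi a) z < tau / 4]).
    apply: decomposition_map_continuous; apply/d_nbhs.
    exists (tau / 4 - d (pi a) (pi x)) => [|z /= xz]; first by rewrite subr_gt0.
    by have := d_tri (pi a) (pi x) z; lra.
  by exists b => // y /bP ay; exists a.
have AW : A `<=` W by move=> x Ax; split; [exact: AU|exists x; rewrite ?dyy].
have [h [hh hW hA hC]] := shrD DA nC oW AW e0.
have [ch [h1 [ch1 hK h1K]]] := hh.
have d_h x : d (pi x) (pi (h x)) < tau / 2.
  have [Wx|nW] := pselect (W x); last by rewrite hW // dyy.
  have [_ [a Aa ax]] := Wx.
  (* Were [h x] outside [W], [h] would fix it, and injectivity would give [h x = x], a point of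
     [W]. *)
  have [_ [b Ab bx]] : W (h x).
    apply: contrapT => nW; case: (nW).
    by have /(can_inj hK) -> := hW _ nW.
  have ab : pi a = pi b by apply/decomposition_map_eq; right; exists A.
  have := d_tri (pi x) (pi a) (pi (h x)); rewrite (dC (pi x) (pi a)) {2}ab.
  lra.
exists (h \o G); split.
- exact: homeomorphism_comp.
- by move=> x nU /=; rewrite GU // hW // => -[].
- move=> x /=; have := d_h (G x); have := Gtau x.
  have := d_tri (pi x) (pi (G x)) (pi (h (G x))); lra.
- move=> A'; rewrite inE => /orP[/eqP ->|A's] x y Ax Ay /=.
    by rewrite !fixA //; exact: hA.
  have [eA|nA] := pselect (A' = A).
    by move: Ax Ay; rewrite eA => Ax Ay; rewrite !fixA //; exact: hA.
  have [||hGA] := hC (G @` A').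
  + exists A' => //; split=> //.
    by case: (sD A'); rewrite ?inE ?A's ?orbT.
  + move=> fixGA; rewrite !fixGA; [exact: (Gs A')|by exists y|by exists x].
  + by apply: hGA; [exists x|exists y].
- move=> A' DA'; have [eA|nA] := pselect (A' = A).
    right=> x y; rewrite eA /= => Ax Ay; rewrite !fixA //; exact: hA.
  have [||hGA] := hC (G @` A').
  + by exists A'.
  + move=> fixGA; have [fG|sG] := GD A' DA'; [left=> x Ax|right=> x y Ax Ay] => /=.
      by rewrite fixGA; [exact: fG|exists x].
    by rewrite !fixGA; [exact: sG|exists y|exists x].
  + by right=> x y Ax Ay; apply: hGA; [exists x|exists y].
Qed.

Lemma null_decomposition_shrinks (e tau : R) : 0 < e -> 0 < tau ->
  exists G : X -> X, [/\ homeomorphism G, forall x, ~ U x -> G x = x,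
    forall x, d (pi x) (pi (G x)) < tau &
    forall x y, pi x = pi y -> mdist (G x) (G y) < e].
Proof.
move=> e0 tau0; have e20 : 0 < e / 2 by rewrite divr_gt0.
(* Elements of diameter above [e / 2] are treated one by one; the others, if fixed, are already
   smaller than [e]. *)
have /finite_seqP[s sE] := nullD e20.
have sP A : A \in s <-> elements D A /\ ((e / 2)%:E < diameter A)%E.
  by rewrite -[X in X <-> _]/([set` s] A) -sE.
have [|G [hG GU Gtau Gs GD]] := shrink_finitely_many (s := s) e0 tau0.
  move=> A /sP[DA eA]; split=> //; apply: DU => // x Ax; move: eA.
  apply/negP; rewrite -leNgt; apply: ge_ereal_sup => _ [y Ay [z Az <-]].
  by move: Ay Az; rewrite Ax => -> ->; rewrite mdistxx lee_fin ltW.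
exists G; split=> // x y /decomposition_map_eq[->|[A DA [Ax Ay]]].
  by rewrite mdistxx.
have [fixA|smallA] := GD A DA; last exact: smallA.
have [As|nAs] := pselect (A \in s); first exact: Gs As _ _ Ax Ay.
rewrite !fixA // ltNge; apply/negP => exy; apply/nAs/sP; split=> //.
by apply: lt_le_trans (diameter_ge Ax Ay); rewrite lte_fin; lra.
Qed.

End NullDecomposition.

Theorem theorem1p1 (R : realType) (X : metricType R) (N : nat)
    (D : decomposition X) (U : set X)
    (d : decomposition_space D -> decomposition_space D -> R) :
  compact [set: X] ->
  null_collection (elements D) ->
  (forall A, elements D A -> recursively_starlike_equivalent R N A) ->
  open U ->
  (forall A, elements D A -> (forall x, A <> [set x]) -> A `<=` U) ->
  compatible_metric d ->
  exists h : nat -> X -> decomposition_space D,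
    [/\ forall m, homeomorphism (h m),
        forall m x, ~ U x -> h m x = decomposition_map D x &
        forall eps : R, 0 < eps ->
          \forall m \near \oo, forall x : X,
            d (h m x) (decomposition_map D x) < eps].
Proof.
move=> cX nullD starD oU DU dD.
have closedD A : elements D A -> closed A.
  by move=> /starD[e [G [[<- _] cG _ _]]]; exact: cG.
have shrD A : elements D A -> shrinkable A.
  by move=> /starD; exact: recursively_starlike_shrinkable.
have /choice[h hP] (m : nat) := bing_shrinking cX
  (@decomposition_map_continuous _ D) (@decomposition_map_surjective _ D) dD
  (null_decomposition_shrinks cX nullD closedD shrD oU DU dD)
  (eps := m.+1%:R^-1) ltac:(by rewrite invr_gt0).
exists h; split=> [m|m|eps /archimedean_inv[n nP]].
- by have [] := hP m.
- by have [] := hP m.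
- exists n => // m /= /nP; move=> mn x; apply: le_lt_trans mn.
  by have [] := hP m.
Qed.
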